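(* Let $m\ge1$ and let $\mathbf d=(e_1,\dots,e_m;d)$, with $0<e_1\le\dots\le e_m<d$, be a dimension vector for the $m$-subspace quiver $Q^{(m)}$ such that: - $\mathbf d$ is related by admissible reflections to a dimension vector belonging to the fundamental domain $\mathrm{F}_{Q^{(m)}}$, - $\langle\mathbf d,\mathbf d\rangle=-3$, - the canonical stability parameter $\Theta_{\rm can}\in\operatorname{Stab}(\mathbf d)$ does not belong to a proper wall, - $\mathbf d$ is (strongly) $\Theta_{\rm can}$-amply stable. Then, up to admissible reflections, $\mathbf d$ is one of the following: - $\mathbf d=(1,2^4;4)$ for $Q^{(5)}$, - $\mathbf d=(1^5,2;3)$ for $Q^{(6)}$, - $\mathbf d=(1^4,2^2;3)$ for $Q^{(6)}$, - $\mathbf d=(1^7;2)$ for $Q^{(7)}$.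
   Context: Representations are over $\mathbb{C}$. The quiver $Q^{(m)}$ has vertices $i_1,\dots,i_m,j$ and arrows $\alpha_k\colon i_k\to j$. The dimension vector $(e_1,\dots,e_m;d)$ has entries $e_k$ at $i_k$ and $d$ at $j$; exponents indicate repeated entries, and vertices $i_1,\dots,i_m$ may be permuted. For a quiver $Q$ with vertex set $Q_0$, the Euler form is $\langle\mathbf d,\mathbf e\rangle=\sum_{i\in Q_0}d_ie_i-\sum_{\alpha\colon i\to j}d_ie_j$, with symmetrization $(\mathbf d,\mathbf e)=\langle\mathbf d,\mathbf e\rangle+\langle\mathbf e,\mathbf d\rangle$. The basis vector at a vertex $i$ is written $\mathbf i$. The fundamental domain $\mathrm{F}_Q$ is the set of $\mathbf d\in\mathbb{N}Q_0$, $\mathbf d\ne0$, with connected support and $(\mathbf d,\mathbf i)\le0$ for all $i\in Q_0$; it depends only on the underlying graph. $\operatorname{Stab}(\mathbf d)$ is the space of $\mathbb{Q}$-linear functionals $\Theta$ on $\mathbb{Q}Q_0$ with $\Theta(\mathbf d)=0$; write $\Theta_i=\Theta(\mathbf i)$. A representation $V$ of dimension vector $\mathbf e$ with $\Theta(\mathbf e)=0$ is $\Theta$-semistable (resp. stable) if $\Theta(\underline{\dim}\,U)\le0$ (resp. $<0$) for all non-zero proper subrepresentations $U$. The canonical stability parameter is $\Theta_{\rm can}=\langle\mathbf d,\_\rangle-\langle\_,\mathbf d\rangle$. $\Theta\in\operatorname{Stab}(\mathbf d)$ belongs to a proper wall if there is a proper non-zero dimension vector $\mathbf e\le\mathbf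 d$ with $\Theta(\mathbf e)=0$ such that there exist $\Theta$-semistable representations of dimension vectors $\mathbf e$ and $\mathbf d-\mathbf e$. $\mathbf d$ is $\Theta$-amply stable if the complement of the $\Theta$-semistable locus in the representation space $\bigoplus_{\alpha\colon i\to j}\operatorname{Hom}(\mathbb{C}^{d_i},\mathbb{C}^{d_j})$ has codimension at least two. It is strongly $\Theta$-amply stable if $\langle\mathbf e,\mathbf d-\mathbf e\rangle\le-2$ for all proper non-zero $\mathbf e\le\mathbf d$ with $\Theta(\mathbf e)>0$; strong ample stability implies ample stability. The result is asserted with either of these as the fourth hypothesis. Admissible reflections. Set $\mathrm{s}_i(\mathbf d)=\mathbf d-(\mathbf d,\mathbf i)\mathbf i$. If $i$ is a sink of $Q$ with $\langle\mathbf d,\mathbf i\rangle\le0$ and $\Theta_i<0$, the admissible reflection at $i$ replaces $(Q,\mathbf d,\Theta)$ by $(\mathrm{s}_i(Q),\mathrm{s}_i(\mathbf d),\mathrm{s}_i(\Theta))$, where $\mathrm{s}_i(Q)$ reverses all arrows pointing to $i$ and $\mathrm{s}_i(\Theta)=\langle\mathrm{s}_i(\alpha),\_\rangle_{\mathrm{s}_i(Q)}$ if $\Theta=\langle\alpha,\_\rangle_Q$. Linear duality replaces $(Q,\mathbf d,\Theta)$ by $(Q^{\rm op},\mathbf d,-\Theta)$, where $Q^{\rm op}$ reverses all arrows; via duality there are analogous reflections at sources. Two pairs $(Q,\mathbf d)$, $(Q',\mathbf d')$ are related by admissible reflections if one is obtained from the other by a sequence of admissible reflections and dualities (here with $\Theta=\Theta_{\rm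 can}$, which these operations preserve). Since reflections change the orientation, the first hypothesis means that $(Q^{(m)},\mathbf d)$ is related to some pair $(Q',\mathbf d')$ with $Q'$ an orientation of the underlying graph of $Q^{(m)}$ and $\mathbf d'\in\mathrm{F}_{Q^{(m)}}$. *)

(* Defs.v *)
From Stdlib Require Import Relation_Operators.
From HB Require Import structures.
From mathcomp Require Import all_boot all_order all_algebra.
From mathcomp Require Import classical_sets reals.
From mathcomp Require Import complex mpoly.

Set Implicit Arguments.
Unset Strict Implicit.
Unset Printing Implicit Defensive.

Import Order.TTheory GRing.Theory Num.Theory.

Local Open Scope ring_scope.

(* Vertex and arrow types are fixed outside the record, because reflections and
   duality only change the orientation of the arrows. *)
Record quiver (V A : finType) := Quiver {
  src : {ffun A -> V};
  tgt : {ffun A -> V}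
}.

Section Quivers.
Variables V A : finType.
Implicit Types (Q : quiver V A) (d e : {ffun V -> nat}) (i : V).
Implicit Types (x y Theta : {ffun V -> rat}).

Definition qdim d : {ffun V -> rat} := [ffun i => (d i)%:R].

Definition basis_vec i : {ffun V -> rat} := [ffun v => (v == i)%:R].

Definition euler Q x y : rat :=
  \sum_(i : V) x i * y i - \sum_(a : A) x (src Q a) * y (tgt Q a).

Definition sym_euler Q x y : rat := euler Q x y + euler Q y x.

(* A linear functional Theta on Q^V is encoded by its values Theta_i on the
   basis vectors; [stab_eval Theta x] is Theta(x). *)
Definition stab_eval Theta x : rat := \sum_(i : V) Theta i * x i.

Definition is_stab d Theta : Prop := stab_eval Theta (qdim d) = 0.

Definition euler_left Q x : {ffun V -> rat} :=
  [ffun i => euler Q x (basis_vec i)].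

Definition euler_right Q x : {ffun V -> rat} :=
  [ffun i => euler Q (basis_vec i) x].

Definition theta_can Q d : {ffun V -> rat} :=
  euler_left Q (qdim d) - euler_right Q (qdim d).

Definition subdim e d : Prop := forall i, (e i <= d i)%N.

Definition compl_dim d e : {ffun V -> nat} := [ffun i => (d i - e i)%N].

Definition proper_subdim e d : Prop := [/\ subdim e d, e != 0 & e != d].

Definition adjacent Q : rel V := fun u v =>
  [exists a, ((src Q a == u) && (tgt Q a == v))
          || ((src Q a == v) && (tgt Q a == u))].

Definition connected_support Q d : Prop :=
  forall u v, d u != 0%N -> d v != 0%N ->
    connect (fun w w' => [&& d w != 0%N, d w' != 0%N & adjacent Q w w']) u v.

Definition in_fundamental_domain Q d : Prop :=
  [/\ d != 0, connected_support Q d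
    & forall i, sym_euler Q (qdim d) (basis_vec i) <= 0].

Definition same_underlying_graph Q Q' : Prop :=
  forall a, (src Q' a = src Q a /\ tgt Q' a = tgt Q a)
         \/ (src Q' a = tgt Q a /\ tgt Q' a = src Q a).

Definition is_sink Q i : Prop := forall a, src Q a != i.

Definition reverse_at Q i : quiver V A :=
  Quiver [ffun a => if tgt Q a == i then i else src Q a]
         [ffun a => if tgt Q a == i then src Q a else tgt Q a].

Definition opposite Q : quiver V A := Quiver (tgt Q) (src Q).

Definition reflect_vec Q i x : {ffun V -> rat} :=
  [ffun v => x v - sym_euler Q x (basis_vec i) * basis_vec i v].

Definition quiver_datum : Type :=
  (quiver V A * {ffun V -> nat} * {ffun V -> rat})%type.

(* Reflections at sources are the composites duality, sink reflection,
   duality. *)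
Inductive admissible_step : quiver_datum -> quiver_datum -> Prop :=
| sink_reflection Q d Theta i d' (alpha : {ffun V -> rat}) :
    is_sink Q i ->
    euler Q (qdim d) (basis_vec i) <= 0 ->
    Theta i < 0 ->
    qdim d' = reflect_vec Q i (qdim d) ->
    Theta = euler_left Q alpha ->
    admissible_step (Q, d, Theta)
      (reverse_at Q i, d', euler_left (reverse_at Q i) (reflect_vec Q i alpha))
| duality Q d Theta :
    admissible_step (Q, d, Theta) (opposite Q, d, - Theta).

Definition obtained_from (D D' : quiver_datum) : Prop :=
  clos_refl_trans _ admissible_step D D'.

Definition related Q d Q' d' : Prop :=
  obtained_from (Q, d, theta_can Q d) (Q', d', theta_can Q' d')
  \/ obtained_from (Q', d', theta_can Q' d') (Q, d, theta_can Q d).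

Section Representations.
Variable F : fieldType.

(* Row-vector convention: M a is the linear map v |-> v *m M a from F^(d_(src a))
   to F^(d_(tgt a)). *)
Definition rep Q d : Type := forall a : A, 'M[F]_(d (src Q a), d (tgt Q a)).

(* A family of subspaces, the one at i being the row space of U i. *)
Definition subspaces d : Type := forall i : V, 'M[F]_(d i).

Definition is_subrep Q d (M : rep Q d) (U : subspaces d) : Prop :=
  forall a, (U (src Q a) *m M a <= U (tgt Q a))%MS.

Definition dim_of d (U : subspaces d) : {ffun V -> nat} :=
  [ffun i => \rank (U i)].

Definition semistable Q d Theta (M : rep Q d) : Prop :=
  is_stab d Theta /\
  forall U : subspaces d, is_subrep M U -> dim_of U != 0 -> dim_of U != d ->
    stab_eval Theta (qdim (dim_of U)) <= 0.

Definition in_proper_wall Q d Theta : Prop :=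
  is_stab d Theta /\
  exists e, [/\ proper_subdim e d,
    stab_eval Theta (qdim e) = 0,
    exists M : rep Q e, semistable Theta M
  & exists N : rep Q (compl_dim d e), semistable Theta N].

(* Matrix entries of a representation: the coordinates of the affine space
   [rep Q d]. *)
Definition coord Q d : finType :=
  {a : A & ('I_(d (src Q a)) * 'I_(d (tgt Q a)))%type}.

Definition coord_val Q d (M : rep Q d) (c : coord Q d) : F :=
  M (tag c) (tagged c).1 (tagged c).2.

Definition peval Q d (p : {mpoly F[#|coord Q d|]}) (M : rep Q d) : F :=
  p.@[fun k => coord_val M (enum_val k)].

Local Open Scope classical_set_scope.

Definition zariski_closed Q d (Z : set (rep Q d)) : Prop :=
  exists S : set {mpoly F[#|coord Q d|]},
    Z = [set M | forall p, S p -> peval p M = 0].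

Definition irreducible_closed Q d (Z : set (rep Q d)) : Prop :=
  [/\ zariski_closed Z, Z !=set0
    & forall Z1 Z2, zariski_closed Z1 -> zariski_closed Z2 ->
        Z `<=` Z1 `|` Z2 -> Z `<=` Z1 \/ Z `<=` Z2].

(* Topological codimension, for the Zariski topology, of a closed subset Z:
   every irreducible closed Y contained in Z starts a strictly increasing chain
   of irreducible closed subsets of length n.  The empty set has infinite
   codimension. *)
Definition codim_ge Q d (n : nat) (Z : set (rep Q d)) : Prop :=
  forall Y, irreducible_closed Y -> Y `<=` Z ->
    exists Y_ : nat -> set (rep Q d),
      [/\ Y_ 0%N = Y,
          forall k, (k <= n)%N -> irreducible_closed (Y_ k)
        & forall k, (k < n)%N -> Y_ k `<` Y_ k.+1].

Definition amply_stable Q d Theta : Prop :=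
  codim_ge 2 (~` [set M : rep Q d | semistable Theta M]).

End Representations.

Definition strongly_amply_stable Q d Theta : Prop :=
  forall e, proper_subdim e d -> 0 < stab_eval Theta (qdim e) ->
    euler Q (qdim e) (qdim d - qdim e) <= - 2%:R.

End Quivers.

(* Vertex [None] is j, vertex [Some k] is i_k (counted from 0), and arrow k
   goes from i_k to j. *)
Definition subspace_quiver (m : nat) : quiver (option 'I_m) 'I_m :=
  Quiver [ffun k => Some k] [ffun _ => None].

Definition subspace_dim (m : nat) (e : m.-tuple nat) (n : nat) :
    {ffun option 'I_m -> nat} :=
  [ffun v => if v is Some k then tnth e k else n].

(* Main.v *)
Require Import Defs.
From HB Require Import structures.
From mathcomp Require Import all_boot all_order all_algebra.
From mathcomp Require Import classical_sets reals.
From mathcomp Require Import complex mpoly.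
From Stdlib Require Import Relation_Operators.
From mathcomp Require Import boolp perm.
From mathcomp Require Import zify ring lra.

(** A dimension vector of the star with hub [j] and arms [i_1, ..., i_m] is
    written (e; n), with n at the hub.  Two involutions govern everything: the
    arm flip C, (e; n) |-> (n - e; n), and the hub reflection S,
    (e; n) |-> (e; sum e - n).

    Orbits.  Give every orientation of the star a normal form by replacing e_l
    with n - e_l on the arms that point away from the hub.  A reflection at an
    arm leaves the normal form unchanged, duality applies C, and a reflection at
    the hub applies C S ([admissible_step_orbit]).  Hence [d] lies in the orbit,
    under the dihedral group generated by C and S, of the normal form [x] of a
    fundamental vector [d'], and <d, d> is constant on this orbit.

    A zero arm.  If [d'] vanishes on an arm k, some vector on the orbit has
    e_k = n, and the simple representation at k destabilises it in codimension
    one, because a square matrix is singular in codimension one.  Since [d] has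
    0 < e_k < n, it is obtained from such a vector by an alternating word
    S, C S, S C S, ... ([orbit_outward]).  The image [b] of the basis vector
    at k under this word is a real root with 0 <= b <= d, and [b] or [d - b]
    violates strong ample stability ([outward_not_strongly_ample]).  For ample
    stability, the functors realising C and S carry the simple representation
    at k to a representation [E] of dimension [b] all of whose quotients, or all
    of whose subrepresentations, have the destabilising sign.  A non-zero
    morphism between [E] and [M] then makes [M] unstable, and such a morphism
    exists exactly when a determinant in the entries of [M] vanishes
    ([hom_determinant]); a hypersurface has codimension one
    ([hypersurface_codim_lt2]).

    No zero arm.  The inequalities of the fundamental domain and <d', d'> = -3
    leave (1^7; 2), (1^6; 3) and (1, 2^4; 4) ([fundamental_minus3]).  Reflections
    at arms join [d] to the normal form [x] and to C x in the subspace
    orientation ([related_subspace]).  For hub dimension 3 the entries of [x]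
    are 1 or 2.  When their sum is divisible by 3, [x] splits into a line
    and a plane of the same slope ([line_plane_wall]), and the functors
    transport this wall along the orbit to [d] ([on_wall_orbit]), against the
    hypothesis.  The remaining vectors are the four in the conclusion. *)

Set Implicit Arguments.
Unset Strict Implicit.
Unset Printing Implicit Defensive.

Import Order.TTheory GRing.Theory Num.Theory.

Local Open Scope ring_scope.

(** * Hypersurfaces have codimension at most one *)

Lemma mpoly_rmorph_eq n (R : comNzRingType) (S : nzRingType)
    (f g : {rmorphism {mpoly R[n]} -> S}) :
  (forall c, f c%:MP = g c%:MP) -> (forall i, f 'X_i = g 'X_i) -> f =1 g.
Proof.
move=> fgC fgX; elim/mpolyind => [|c m p _ _ IHp]; first by rewrite !rmorph0.
rewrite !rmorphD IHp -mul_mpolyC !rmorphM fgC mpolyXE_id !rmorph_prod.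
congr (_ * _ + _); apply: eq_bigr => i _.
by rewrite !rmorphXn fgX.
Qed.

Section MainVariable.
Variables (F : fieldType) (n : nat) (k0 : 'I_n.+1).

(** Polynomials in n + 1 variables, read as univariate polynomials in the
    variable [k0] over the polynomials in the others; [merge_in] is the inverse
    direction, and [eval_out] is evaluation at a point in this reading. *)
Definition single_out : {mpoly F[n.+1]} -> {poly {mpoly F[n]}} :=
  mmap (polyC \o @mpolyC n F)
       (fun k => if unlift k0 k is Some j then ('X_j)%:P else 'X).

HB.instance Definition _ := GRing.RMorphism.on single_out.

Definition widen_lift : {mpoly F[n]} -> {mpoly F[n.+1]} :=
  mmap (@mpolyC n.+1 F) (fun j => 'X_(lift k0 j)).

HB.instance Definition _ := GRing.RMorphism.on widen_lift.

Definition merge_in (g : {poly {mpoly F[n]}}) : {mpoly F[n.+1]} :=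
  horner_eval 'X_k0 (map_poly widen_lift g).

HB.instance Definition _ := GRing.RMorphism.copy merge_in
  (horner_eval 'X_k0 \o map_poly widen_lift).

Definition eval_out (v : 'I_n.+1 -> F) (g : {poly {mpoly F[n]}}) : F :=
  horner_eval (v k0) (map_poly (meval (v \o lift k0)) g).

HB.instance Definition _ v := GRing.RMorphism.copy (eval_out v)
  (horner_eval (v k0) \o map_poly (meval (v \o lift k0))).

Lemma eval_outC v c : eval_out v c%:P = c.@[v \o lift k0].
Proof. by rewrite /eval_out map_polyC /horner_eval hornerC. Qed.

Lemma single_outC c : single_out c%:MP = (c%:MP)%:P.
Proof. exact: mmapC. Qed.

Lemma single_outX k :
  single_out 'X_k = if unlift k0 k is Some j then ('X_j)%:P else 'X.
Proof. by rewrite /single_out mmapX mmap1U. Qed.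

Lemma widen_liftC c : widen_lift c%:MP = c%:MP.
Proof. exact: mmapC. Qed.

Lemma widen_liftX j : widen_lift 'X_j = 'X_(lift k0 j).
Proof. by rewrite /widen_lift mmapX mmap1U. Qed.

Lemma single_outK : cancel single_out merge_in.
Proof.
apply: (@mpoly_rmorph_eq _ _ _ (merge_in \o single_out) idfun) => [c|k].
  rewrite [LHS]/= single_outC /merge_in map_polyC /horner_eval hornerC.
  exact: widen_liftC.
rewrite [LHS]/= single_outX /merge_in /horner_eval.
case: unliftP => [j ->|->].
  by rewrite map_polyC hornerC; exact: widen_liftX.
by rewrite map_polyX hornerX.
Qed.

Lemma meval_merge_in v g : (merge_in g).@[v] = eval_out v g.
Proof.
have ev_lift : meval v \o widen_lift =1 meval (v \o lift k0).
  apply: mpoly_rmorph_eq => [c|j]; rewrite [LHS]/=.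
    by rewrite widen_liftC mevalC [RHS]mevalC.
  by rewrite widen_liftX mevalXU [RHS]mevalXU.
transitivity (map_poly (meval v) (map_poly widen_lift g)).[('X_k0).@[v]].
  exact: esym (horner_map _ _ _).
rewrite mevalXU -map_poly_comp /eval_out /horner_eval.
by congr horner; apply: eq_map_poly.
Qed.

Lemma eval_single_out v p : eval_out v (single_out p) = p.@[v].
Proof. by rewrite -meval_merge_in single_outK. Qed.

Lemma eval_single_outM v p q :
  eval_out v (single_out p * single_out q) = p.@[v] * q.@[v].
Proof.
rewrite -mevalM -eval_single_out; congr eval_out.
exact: esym (rmorphM single_out p q).
Qed.

End MainVariable.

(** An algebraically closed field is infinite, so the coefficients can be made
    non-zero first and the main variable chosen afterwards. *)
Lemma mpoly_nonroot (F : closedFieldType) n (p : {mpoly F[n]}) :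
  p != 0 -> exists v, p.@[v] != 0.
Proof.
elim: n p => [|n IHn] p p_neq0.
  exists (fun=> 0); move: p_neq0.
  have -> : p = (p@_0%MM)%:MP.
    apply/mpolyP => m; rewrite mcoeffC.
    have -> : m = 0%MM by apply/mnmP => -[].
    by rewrite eqxx mulr1.
  by rewrite mevalC; apply: contra_neq => ->; rewrite mpolyC0.
have g_neq0 : single_out ord0 p != 0.
  apply: contra_neq p_neq0 => g0.
  by rewrite -(single_outK ord0 p) g0 rmorph0.
have := g_neq0; rewrite -lead_coef_eq0 => /IHn[w w_lead].
have : map_poly (meval w) (single_out ord0 p) != 0.
  by rewrite -size_poly_eq0 size_map_poly_id0 // size_poly_eq0.
case/closed_nonrootP => t t_nonroot.
exists (fun i => if unlift ord0 i is Some j then w j else t).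
rewrite -(eval_single_out ord0) /eval_out unlift_none.
by under eq_map_poly => c do under meval_eq => j do rewrite /= liftK.
Qed.

(** Irreducibility is relative to divisibility up to scalars, that is, over the
    fraction field of the coefficients; a factor of least degree has it. *)
Lemma irreducible_factor (A : idomainType) (f : {poly A}) :
  (1 < size f)%N -> exists2 h, irreducible_poly h & h %| f.
Proof.
have [s] := ubnP (size f); elim: s f => // s IHs f lt_f f_gt1.
have [irr_f|] := pselect (irreducible_poly f); first by exists f.
move=> /not_andP[//|] /existsNP[q] /not_implyP[q_neq1].
move=> /not_implyP[q_dvd] /negP q_neq.
have f_neq0 : f != 0 by rewrite -size_poly_gt0 ltnW.
have q_neq0 : q != 0 by apply: contraTneq q_dvd => ->; rewrite dvd0p.
have q_gt1 : (1 < size q)%N.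
  by move: q_neq1; rewrite neq_ltn ltnS leqn0 size_poly_eq0 (negPf q_neq0).
have lt_q : (size q < size f)%N.
  by rewrite ltn_neqAle (dvdp_size_eqp q_dvd) q_neq dvdp_leq.
have [h irr_h h_dvd] := IHs q (leq_trans lt_q lt_f) q_gt1.
by exists h => //; apply: dvdp_trans q_dvd.
Qed.

Section IrreducibleHypersurface.
Variables (F : closedFieldType) (n : nat) (k0 : 'I_n.+1).
Variable h : {poly {mpoly F[n]}}.
Hypothesis irr_h : irreducible_poly h.
Implicit Types (g p q : {poly {mpoly F[n]}}).

(** The ideal of [h] is taken up to scalars from the coefficient ring: it is the
    contraction of the ideal generated by [h] over the fraction field, hence
    prime, and it contains no non-zero constant polynomial. *)
Definition on_hypersurface (v : 'I_n.+1 -> F) : Prop :=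
  forall q, h %| q -> eval_out k0 v q = 0.

(** If [h] did not divide [g], a Bezout relation would produce a non-zero constant
    [c] in the ideal of [g] and [h].  A point over which neither [c] nor the
    leading coefficient of [h] vanishes lifts to a root of [h], and this root
    lies on the hypersurface, where [g] vanishes but [c] does not. *)
Lemma hypersurface_nullstellensatz g :
  (forall v, on_hypersurface v -> eval_out k0 v g = 0) -> h %| g.
Proof.
move=> van_g; apply: contrapT => /negP; rewrite -(irreducible_poly_coprime _ irr_h).
move=> /Pdiv.Idomain.Bezout_coprimepP[[u w]] /= /eqp_size.
rewrite size_poly1 => /eqP/size_poly1P[c c_neq0 bezout].
have h_neq0 := irredp_neq0 irr_h.
(* Over this point the degree of [h] does not drop, and [c] survives. *)
have : c * lead_coef h != 0 by rewrite mulf_neq0 ?lead_coef_eq0.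
case/mpoly_nonroot => x; rewrite mevalM mulf_eq0 negb_or => /andP[cx_neq0 lx_neq0].
have : size (map_poly (meval x) h) != 1.
  by rewrite size_map_poly_id0 //; case: irr_h; case: size => [|[|]].
case/closed_rootP => t /rootP ht0.
pose v i := if unlift k0 i is Some j then x j else t.
have evE g' : eval_out k0 v g' = (map_poly (meval x) g').[t].
  rewrite /eval_out /horner_eval {2}/v unlift_none; congr horner.
  by apply: eq_map_poly => c'; apply: meval_eq => j; rewrite /= /v liftK.
have evC c' : eval_out k0 v c'%:P = c'.@[x].
  by rewrite evE map_polyC hornerC.
have on_v : on_hypersurface v.
  move=> q /Pdiv.Idomain.divpK /(congr1 (eval_out k0 v)).
  rewrite -mul_polyC !rmorphM /= (evE h) ht0 mulr0 evC rmorphXn /=.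
  move/esym/eqP; rewrite mulf_eq0 expf_eq0 (negPf lx_neq0) andbF.
  by move/eqP.
have := congr1 (eval_out k0 v) bezout.
rewrite rmorphD !rmorphM /= (evE h) ht0 (van_g v on_v) !mulr0 addr0 evC.
by move/esym/eqP; rewrite (negPf cx_neq0).
Qed.

(** The ideal of [h] has height one.  A non-zero element of least degree of a
    prime ideal contained in it is a multiple of [h]; the cofactor has smaller
    degree, so by primality [h] itself belongs to the prime ideal, which is then
    the whole ideal of [h]. *)
Lemma prime_ideal_on_hypersurface (W : set ('I_n.+1 -> F)) :
  (forall g q, (forall v, W v -> eval_out k0 v (g * q) = 0) ->
     (forall v, W v -> eval_out k0 v g = 0)
     \/ (forall v, W v -> eval_out k0 v q = 0)) ->
  (forall g, (forall v, W v -> eval_out k0 v g = 0) -> h %| g) ->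
  (exists2 g, g != 0 & forall v, W v -> eval_out k0 v g = 0) ->
  forall v, W v -> on_hypersurface v.
Proof.
set I := fun g => forall v, W v -> eval_out k0 v g = 0.
move=> prime_I sub_I [g0 g0_neq0 I_g0].
have [g [g_neq0 I_g] min_g] : exists2 g, g != 0 /\ I g &
    forall q, q != 0 -> I q -> (size g <= size q)%N.
  have [s] := ubnP (size g0); elim: s g0 g0_neq0 I_g0 => // s IHs g g_neq0 I_g.
  rewrite ltnS => le_g.
  have [[q [q_neq0 I_q lt_q]]|no_q] :=
      pselect (exists q, [/\ q != 0, I q & (size q < size g)%N]).
    exact: IHs q q_neq0 I_q (leq_trans lt_q le_g).
  exists g => // q q_neq0 I_q; rewrite leqNgt; apply/negP => lt_q.
  by apply: no_q; exists q.
have no_const (c : {mpoly F[n]}) : c != 0 -> ~ I c%:P.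
  move=> c_neq0 /sub_I /dvdp_leq; rewrite polyC_eq0 => /(_ c_neq0).
  by rewrite size_polyC c_neq0 leqNgt; case: irr_h => ->.
have h_neq0 := irredp_neq0 irr_h.
have I_scale c q : c != 0 -> I (c *: q) -> I q.
  by rewrite -mul_polyC => c_neq0 /prime_I[/(no_const _ c_neq0)|].
have I_h : I h.
  have /Pdiv.Idomain.dvdpP[[c w] /= c_neq0 gE] := sub_I _ I_g.
  have w_neq0 : w != 0.
    have : c *: g != 0 by rewrite scale_poly_eq0 negb_or c_neq0.
    by rewrite gE mulf_eq0 negb_or => /andP[].
  have /prime_I[I_w|//] : I (w * h).
    by move=> v Wv; rewrite -gE -mul_polyC rmorphM /= I_g ?mulr0.
  have := min_g _ w_neq0 I_w; rewrite -(size_scale g c_neq0) gE size_mul //.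
  by case: irr_h; case: (size h) => [|[|k]] // _ _; rewrite !addnS /= leqNgt ltnS leq_addr.
move=> v Wv q /Pdiv.Idomain.dvdpP[[c w] /= c_neq0 qE].
apply: (I_scale c) => // v' Wv'.
by rewrite qE rmorphM /= I_h ?mulr0.
Qed.

End IrreducibleHypersurface.

(** Passing from [v0] to [v1] one coordinate at a time, the value changes at some
    step, and the coordinate of this step occurs in [f]. *)
Lemma nonconstant_main_variable (F : fieldType) n (f : {mpoly F[n.+1]}) v0 v1 :
  f.@[v1] != f.@[v0] -> exists k0, (1 < size (single_out k0 f))%N.
Proof.
move=> f01; apply: contrapT => /forallNP const_f; case/eqP: f01.
(* The hybrid points: [v1] on the first [i] coordinates, [v0] on the others. *)
pose w i (k : 'I_n.+1) := if (k < i)%N then v1 k else v0 k.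
have step i : (i < n.+1)%N -> f.@[w i] = f.@[w i.+1].
  move=> lt_i; pose k0 := Ordinal lt_i.
  have /size1_polyC sE : (size (single_out k0 f) <= 1)%N.
    by rewrite leqNgt; apply/negP/const_f.
  rewrite -!(eval_single_out k0) sE !eval_outC; apply: meval_eq => j.
  have := neq_lift k0 j; rewrite /w /= ltnS -val_eqE /= => neq_j.
  by congr (if _ then _ else _); rewrite [RHS]leq_eqVlt eq_sym (negPf neq_j).
have all_steps i : (i <= n.+1)%N -> f.@[w 0%N] = f.@[w i].
  elim: i => [//|i IHi] lt_i.
  exact: etrans (IHi (ltnW lt_i)) (step i lt_i).
transitivity f.@[w n.+1]; last exact: esym (all_steps _ (leqnn _)).
by apply: meval_eq => k; rewrite /w ltn_ord.
Qed.

Section Codimension.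
Local Open Scope classical_set_scope.

(** An irreducible component of a hypersurface: above it there is no chain of
    length two, since an irreducible closed set that strictly contains it and is
    not the whole space would have a prime ideal strictly between zero and the
    ideal of [h]. *)
Lemma hypersurface_component (F : closedFieldType) (T : Type) N
    (ev : T -> 'I_N -> F) (ev_surj : forall v, exists t, ev t = v)
    (f : {mpoly F[N]}) t0 t1 :
  let closed (Z : set T) :=
    exists S : set {mpoly F[N]}, Z = [set t | forall p, S p -> p.@[ev t] = 0] in
  let irreducible Z := [/\ closed Z, Z !=set0
    & forall Z1 Z2, closed Z1 -> closed Z2 ->
        Z `<=` Z1 `|` Z2 -> Z `<=` Z1 \/ Z `<=` Z2] in
  f.@[ev t0] = 0 -> f.@[ev t1] != 0 ->
  exists Y, [/\ irreducible Y, Y `<=` [set t | f.@[ev t] = 0]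
    & forall Y1 Y2, irreducible Y1 -> irreducible Y2 ->
        Y `<` Y1 -> ~ Y1 `<` Y2].
Proof.
case: N ev ev_surj f => [|n] ev ev_surj f closed irreducible f0 f1.
  by case/eqP: f1; rewrite -f0; apply: meval_eq => -[].
have [k0 f_gt1] : exists k0, (1 < size (single_out k0 f))%N.
  by apply: (nonconstant_main_variable (v0 := ev t0) (v1 := ev t1)); rewrite f0.
have [h irr_h h_dvd_f] := irreducible_factor f_gt1.
pose Y := [set t | on_hypersurface k0 h (ev t)].
have vanY g : (forall t, Y t -> eval_out k0 (ev t) g = 0) -> h %| g.
  move=> vang; apply: (hypersurface_nullstellensatz (k0 := k0) irr_h) => v on_v.
  by have [t tE] := ev_surj v; rewrite -tE; apply: vang; rewrite /Y /= tE.
have closed1 g : closed [set t | eval_out k0 (ev t) g = 0].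
  exists [set merge_in k0 g]; apply/seteqP; split => t /=.
    by move=> g0 _ ->; rewrite meval_merge_in.
  by move=> /(_ _ erefl); rewrite meval_merge_in.
exists Y; split; first split.
- exists [set p | exists2 q, h %| q & p = merge_in k0 q].
  apply/seteqP; split => t /=.
    by move=> Yt _ [q h_dvd ->]; rewrite meval_merge_in; apply: Yt.
  by move=> van q h_dvd; rewrite -meval_merge_in; apply: van; exists q.
- apply/set0P/eqP => Y0; have : h %| 1 by apply: vanY => t; rewrite Y0.
  move/dvdp_leq; rewrite oner_eq0 size_poly1 leqNgt => /(_ isT).
  by case: irr_h => ->.
- move=> Z1 Z2 [S1 ->] [S2 ->] subY.
  apply: contrapT => /not_orP[/existsNP[s1 /not_implyP[Ys1]]].
  move=> /existsNP[p1 /not_implyP[S1p1 p1s1]] /existsNP[s2 /not_implyP[Ys2]].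
  move=> /existsNP[p2 /not_implyP[S2p2 p2s2]].
  have : h %| single_out k0 p1 * single_out k0 p2.
    apply: vanY => t /subY[/(_ _ S1p1) e|/(_ _ S2p2) e].
      by rewrite eval_single_outM e mul0r.
    by rewrite eval_single_outM e mulr0.
  have := irreducible_poly_coprime (single_out k0 p1) irr_h.
  case: (boolP (h %| single_out k0 p1)) => [/Ys1|_ cop].
    by rewrite eval_single_out.
  by rewrite Pdiv.Idomain.Gauss_dvdpr // => /Ys2; rewrite eval_single_out.
- by move=> t /(_ _ h_dvd_f); rewrite eval_single_out.
move=> Y1 Y2 [[S1 Y1E] _ irrY1] _ [sub01 nsub10] [sub12 nsub21]; apply: nsub10.
pose W v := exists2 t, Y1 t & ev t = v.
move=> t Y1t; apply: (prime_ideal_on_hypersurface irr_h (W := W)); last by exists t.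
- move=> g q van; have [s Y1s|sub|sub] := irrY1 _ _ (closed1 g) (closed1 q).
  + have /eqP : eval_out k0 (ev s) g * eval_out k0 (ev s) q = 0.
      rewrite -(rmorphM (eval_out k0 (ev s)) g q); apply: van; by exists s.
    by rewrite mulf_eq0 => /orP[]/eqP; [left | right].
  + by left => _ [s Y1s <-]; apply: sub.
  + by right => _ [s Y1s <-]; apply: sub.
- move=> g van; apply: vanY => s /sub01 Y1s; apply: van; by exists s.
have /existsNP[s /not_implyP[Y2s]] := nsub21.
rewrite {1}Y1E => /existsNP[p /not_implyP[S1p ps]].
exists (single_out k0 p); last first.
  by move=> _ [s' Y1s' <-]; rewrite eval_single_out; move: Y1s'; rewrite Y1E; apply.
by apply: contra_notN ps => /eqP p0; rewrite -(eval_single_out k0) p0 rmorph0.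
Qed.

Lemma hypersurface_codim_lt2 (F : closedFieldType) (V A : finType)
    (Q : quiver V A) (d : {ffun V -> nat}) (f : {mpoly F[#|Defs.coord Q d|]})
    (Z : set (rep F Q d)) M0 M1 :
  peval f M0 = 0 -> peval f M1 != 0 -> (forall M, peval f M = 0 -> Z M) ->
  ~ codim_ge 2 Z.
Proof.
move=> f0 f1 fZ codimZ.
pose ev (M : rep F Q d) (k : 'I_#|Defs.coord Q d|) := coord_val M (enum_val k).
have ev_surj (v : 'I_#|Defs.coord Q d| -> F) : exists M, ev M = v.
  exists (fun a => \matrix_(i, j) v (enum_rank (Tagged _ (i, j) : Defs.coord Q d))).
  apply: funext => k; rewrite /ev /coord_val mxE -[RHS]/(v k); congr v.
  apply: (canLR enum_valK); case: (enum_val k) => a [i j] //=.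
have [Y [irrY subY topY]] := hypersurface_component ev_surj f0 f1.
have [//|M /subY/fZ//|Y_ [Y0 irrY_ incrY_]] := codimZ Y.
apply: (topY (Y_ 1%N) (Y_ 2%N)); [exact: irrY_|exact: irrY_| |exact: incrY_].
by rewrite -Y0; apply: incrY_.
Qed.

End Codimension.

(** * Determinantal equations for morphisms *)

Section Determinants.
Variables (F : fieldType) (V A : finType) (Q : quiver V A).
Variable d : {ffun V -> nat}.
Implicit Types (M : rep F Q d).

Definition is_morphism (d1 d2 : {ffun V -> nat}) (M1 : rep F Q d1)
    (M2 : rep F Q d2) (phi : forall v, 'M[F]_(d1 v, d2 v)) : Prop :=
  forall a, M1 a *m phi (tgt Q a) = phi (src Q a) *m M2 a.

Definition nonzero_morphism (d1 d2 : {ffun V -> nat}) (M1 : rep F Q d1)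
    (M2 : rep F Q d2) : Prop :=
  exists phi, is_morphism M1 M2 phi /\ exists v, phi v != 0.

Definition polynomial_in_rep (g : rep F Q d -> F) : Prop :=
  exists p : {mpoly F[#|Defs.coord Q d|]}, forall M, peval p M = g M.

Lemma polynomial_const c : polynomial_in_rep (fun=> c).
Proof. by exists c%:MP => M; rewrite /peval mevalC. Qed.

Lemma polynomial_entry a i j : polynomial_in_rep (fun M => M a i j).
Proof.
exists 'X_(enum_rank (Tagged _ (i, j) : Defs.coord Q d)) => M.
by rewrite /peval mevalXU enum_rankK.
Qed.

Lemma polynomialD g h : polynomial_in_rep g -> polynomial_in_rep h ->
  polynomial_in_rep (fun M => g M + h M).
Proof.
by move=> [p pE] [q qE]; exists (p + q) => M; rewrite -pE -qE /peval mevalD.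
Qed.

Lemma polynomialM g h : polynomial_in_rep g -> polynomial_in_rep h ->
  polynomial_in_rep (fun M => g M * h M).
Proof.
by move=> [p pE] [q qE]; exists (p * q) => M; rewrite -pE -qE /peval mevalM.
Qed.

Lemma polynomial_sum (I : finType) (g : I -> rep F Q d -> F) :
  (forall i, polynomial_in_rep (g i)) ->
  polynomial_in_rep (fun M => \sum_i g i M).
Proof.
move=> /choice[p pE]; exists (\sum_i p i) => M.
by rewrite /peval raddf_sum; apply: eq_bigr => i _; exact: pE.
Qed.

Lemma polynomial_prod (I : finType) (g : I -> rep F Q d -> F) :
  (forall i, polynomial_in_rep (g i)) ->
  polynomial_in_rep (fun M => \prod_i g i M).
Proof.
move=> /choice[p pE]; exists (\prod_i p i) => M.
by rewrite /peval rmorph_prod; apply: eq_bigr => i _; exact: pE.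
Qed.

(** A square linear system has a non-zero solution exactly when its determinant
    vanishes, and the determinant is polynomial in the entries. *)
Lemma polynomial_linear_system (I J : finType)
    (c : rep F Q d -> I -> J -> F) : #|I| = #|J| ->
  (forall i j, polynomial_in_rep (fun M => c M i j)) ->
  exists f : {mpoly F[#|Defs.coord Q d|]}, forall M, peval f M = 0 <->
    exists x : I -> F, (exists i, x i != 0) /\ forall j, \sum_i x i * c M i j = 0.
Proof.
move=> eqIJ poly_c.
pose C M := \matrix_(k < #|I|, l < #|I|)
              c M (enum_val k) (enum_val (cast_ord eqIJ l)).
have [f fE] : polynomial_in_rep (fun M => \det (C M)).
  apply: polynomial_sum => s; apply: polynomialM; first exact: polynomial_const.
  apply: polynomial_prod => k.
  have [p pE] := poly_c (enum_val k) (enum_val (cast_ord eqIJ (s k))).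
  by exists p => M; rewrite mxE.
exists f => M; rewrite fE; split.
  move/eqP/det0P => [v v_neq0 vC0]; exists (fun i => v 0 (enum_rank i)); split.
    have /rV0Pn[k vk] := v_neq0.
    by exists (enum_val k); rewrite enum_valK.
  move=> j; pose l := cast_ord (esym eqIJ) (enum_rank j).
  have := congr1 (fun B : 'rV_ _ => B 0 l) vC0; rewrite !mxE => vC0j; rewrite -[RHS]vC0j.
  rewrite (reindex (enum_val : 'I_#|I| -> I)) /=; last exact/onW_bij/enum_val_bij.
  by apply: eq_bigr => k _; rewrite mxE enum_valK cast_ordKV enum_rankK.
move=> [x [[i xi] xC0]]; apply/eqP/det0P.
exists (\row_k x (enum_val k)).
  by apply/rV0Pn; exists (enum_rank i); rewrite mxE enum_rankK.
apply/rowP => l; rewrite !mxE -[RHS](xC0 (enum_val (cast_ord eqIJ l))).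
rewrite [RHS](reindex (enum_val : 'I_#|I| -> I)) /=; last exact/onW_bij/enum_val_bij.
by apply: eq_bigr => k _; rewrite !mxE.
Qed.

Lemma sum_delta (I : finType) (x : I -> F) (i0 : I) y :
  \sum_i x i * (y * (i == i0)%:R) = x i0 * y.
Proof.
rewrite (bigD1 i0) //= eqxx mulr1 big1 ?addr0 // => i /negPf ->.
by rewrite !mulr0.
Qed.

Lemma card_hom (I : finType) (p q : I -> nat) :
  #|{: {i : I & ('I_(p i) * 'I_(q i))%type}}| = (\sum_i p i * q i)%N.
Proof.
rewrite card_tagged sumnE big_map big_enum /=; apply: eq_bigr => i _.
by rewrite card_prod !card_ord.
Qed.

(** <d1, d2> = 0 says that the equations defining Hom(M1, M2) are as many as the
    unknowns. *)
Lemma euler0_card (d1 d2 : {ffun V -> nat}) :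
  euler Q (qdim d1) (qdim d2) = 0 ->
  (\sum_v d1 v * d2 v = \sum_a d1 (src Q a) * d2 (tgt Q a))%N.
Proof.
move=> /eqP; rewrite /euler subr_eq0 => /eqP e0; apply/eqP.
rewrite -(eqr_nat rat) !natr_sum; apply/eqP.
transitivity (\sum_v qdim d1 v * qdim d2 v).
  by apply: eq_bigr => v _; rewrite !ffunE natrM.
by rewrite e0; apply: eq_bigr => a _; rewrite !ffunE natrM.
Qed.

(** The equations M1 phi = phi M2 form a linear system in [phi], square by
    [euler0_card]; its determinant is the Schofield semi-invariant. *)
Lemma hom_determinant (d1 d2 : {ffun V -> nat})
    (M1 : rep F Q d -> rep F Q d1) (M2 : rep F Q d -> rep F Q d2) :
  (forall a i j, polynomial_in_rep (fun M => M1 M a i j)) ->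
  (forall a i j, polynomial_in_rep (fun M => M2 M a i j)) ->
  euler Q (qdim d1) (qdim d2) = 0 ->
  exists f : {mpoly F[#|Defs.coord Q d|]},
    forall M, peval f M = 0 <-> nonzero_morphism (M1 M) (M2 M).
Proof.
move=> poly1 poly2 /euler0_card; rewrite -!card_hom => eqIJ.
pose I : finType := {v : V & ('I_(d1 v) * 'I_(d2 v))%type}.
pose J : finType := {a : A & ('I_(d1 (src Q a)) * 'I_(d2 (tgt Q a)))%type}.
pose c M (i : I) (j : J) :=
  let: existT a (r, s) := j in
  \sum_k M1 M a r k * (i == Tagged _ (k, s))%:R
  + - 1 * \sum_k M2 M a k s * (i == Tagged _ (r, k))%:R.
have poly_c i j : polynomial_in_rep (fun M => c M i j).
  case: j => a [r s]; rewrite /c; apply: polynomialD.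
    apply: polynomial_sum => k; apply: polynomialM; first exact: poly1.
    exact: polynomial_const.
  apply: polynomialM; first exact: polynomial_const.
  apply: polynomial_sum => k; apply: polynomialM; first exact: poly2.
  exact: polynomial_const.
have [f fE] := @polynomial_linear_system I J c eqIJ poly_c.
pose phi_of (x : I -> F) v : 'M_(d1 v, d2 v) := \matrix_(r, s) x (Tagged _ (r, s) : I).
have cE M x a r s : \sum_i x i * c M i (Tagged (fun a => _) (r, s) : J) =
    (M1 M a *m phi_of x (tgt Q a) - phi_of x (src Q a) *m M2 M a) r s.
  rewrite !mxE; under eq_bigr do rewrite mulrDr !mulr_sumr.
  rewrite big_split /= exchange_big [X in _ + X]exchange_big -sumrN /=.
  congr (_ + _); apply: eq_bigr => k _; rewrite mxE.
    by rewrite sum_delta mulrC.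
  rewrite -[RHS]mulrN; under eq_bigr do rewrite mulrA; rewrite sum_delta.
  by rewrite mulrN1 mulNr mulrN.
exists f => M; rewrite fE; split=> [[x [[[v [r s]] xi] x0]]|[phi [morphi [v phiv]]]].
  exists (phi_of x); split => [a|].
    by apply/eqP; rewrite -subr_eq0; apply/eqP/matrixP => i j; rewrite -cE x0 mxE.
  by exists v; apply: contraNneq xi => phi0; move/matrixP/(_ r s): phi0; rewrite !mxE => ->.
pose x (i : I) := let: existT v (r, s) := i in phi v r s.
have phiE u : phi_of x u = phi u by apply/matrixP => r s; rewrite mxE.
exists x; split; last by move=> [a [r s]]; rewrite cE !phiE morphi subrr mxE.
have /matrix0Pn[r [s rs]] := phiv.
by exists (Tagged (fun u => _) (r, s) : I).
Qed.

Lemma hom_from_determinant (b : {ffun V -> nat}) (E : rep F Q b) :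
  euler Q (qdim b) (qdim d) = 0 ->
  exists f : {mpoly F[#|Defs.coord Q d|]},
    forall M, peval f M = 0 <-> nonzero_morphism E M.
Proof.
apply: (hom_determinant (M1 := fun=> E) (M2 := id)) => a i j.
  exact: polynomial_const.
exact: polynomial_entry.
Qed.

Lemma hom_to_determinant (b : {ffun V -> nat}) (E : rep F Q b) :
  euler Q (qdim d) (qdim b) = 0 ->
  exists f : {mpoly F[#|Defs.coord Q d|]},
    forall M, peval f M = 0 <-> nonzero_morphism M E.
Proof.
apply: (hom_determinant (M1 := id) (M2 := fun=> E)) => a i j.
  exact: polynomial_entry.
exact: polynomial_const.
Qed.

End Determinants.

(** * Complementary star representations *)

Lemma row_basis (F : fieldType) k q r (A : 'M[F]_(k, q)) : \rank A = r ->
  exists B : 'M_(r, q), row_free B /\ (B :=: A)%MS.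
Proof.
by move=> <-; exists (row_base A); split; [apply: row_base_free | apply: eq_row_base].
Qed.

Lemma submxcol_sub (F : fieldType) m (p : 'I_m -> nat) q
    (A : 'M[F]_(\sum_l p l, q)) l : (submxcol A l <= A)%MS.
Proof. exact: rowsub_sub. Qed.

Section Stars.
Variables (F : fieldType) (m : nat).
Implicit Types (p u : 'I_m -> nat) (q w : nat).

(** A representation of the subspace quiver, with dimensions [p l] on the arms
    and [q] at the hub. *)
Definition star p q : Type := forall l, 'M[F]_(p l, q).

(** Stability depends only on the dimensions of subrepresentations, so the
    functors below are described by what they do to these dimensions. *)
Definition has_substar p q (N : star p q) u w : Prop :=
  exists (U : forall l, 'M_(p l)) (W : 'M_q),
    [/\ forall l, (U l *m N l <= W)%MS, forall l, \rank (U l) = u l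
      & \rank W = w].

Lemma has_substar_leq p q (N : star p q) u w : has_substar N u w ->
  (forall l, (u l <= p l)%N) /\ (w <= q)%N.
Proof.
move=> [U [W [_ rU rW]]]; rewrite -rW rank_leq_row; split=> // l.
by rewrite -rU rank_leq_row.
Qed.

(** The functor behind the arm flip: each subspace is replaced by its annihilator
    in the dual of the hub.  A subrepresentation (U', W') upstairs comes from
    the quotient by (U, W), where W annihilates W' and U is the part of the arms
    lying in W. *)
Lemma complement_star p q (N : star p q) : (forall l, row_free (N l)) ->
  exists N' : star (fun l => q - p l)%N q,
    forall u' w', has_substar N' u' w' ->
      exists2 u, has_substar N u (q - w')
               & forall l, (u' l + p l <= w' + u l)%N.
Proof.
move=> freeN.
have basis l : exists B : 'M_((q - p l)%N, q),
    row_free B /\ (B :=: kermx (N l)^T)%MS.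
  by apply: row_basis; rewrite mxrank_ker mxrank_tr (eqP (freeN l)).
exists (fun l => sval (cid (basis l))) => u' w' [U' [W' [subU' rU' rW']]].
exists (fun l => p l - \rank (N l *m W'^T))%N => [|l].
  exists (fun l => kermx (N l *m W'^T)), (kermx W'^T); split => [l|l|].
  - by apply/sub_kermxP; rewrite -mulmxA mulmx_ker.
  - exact: mxrank_ker.
  - by rewrite mxrank_ker mxrank_tr rW'.
have le_p := rank_leq_row (N l *m W'^T).
(* The functionals of U' lie in W' and restrict to zero on the arm: rank-nullity. *)
suff : (u' l + \rank (N l *m W'^T) <= w')%N by lia.
have := subU' l; case: cid => B /= [freeB defB] subB.
rewrite -mxrank_tr trmx_mul trmxK -rW' -(mxrank_mul_ker W' (N l)^T) addnC.
rewrite leq_add2l -rU' -(mxrankMfree _ freeB) mxrankS // sub_capmx subB /=.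
by rewrite -defB submxMl.
Qed.

(** The functor behind the hub reflection: the hub is replaced by the dual of the
    kernel of the sum map from the arms.  A subrepresentation (U', W') of the
    result is matched with the annihilators of the U' and with their image in
    the old hub. *)
Lemma reflect_star p q (N : star p q) : \rank (\mxcol_l N l) = q ->
  exists N' : star p (\sum_l p l - q)%N,
    forall u' w', has_substar N' u' w' ->
      exists2 w, has_substar N (fun l => p l - u' l)%N w
               & (w + \sum_l u' l <= q + w')%N.
Proof.
set A := \mxcol_l N l => rA.
have [B [freeB defB]] : exists B : 'M_((\sum_l p l - q)%N, \sum_l p l),
    row_free B /\ (B :=: kermx A)%MS.
  by apply: row_basis; rewrite mxrank_ker rA.
exists (fun l => (submxrow B l)^T) => u' w' [U' [W' [subU' rU' rW']]].
pose U l := kermx (U' l)^T.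
pose D := \mxdiag_l U l.
exists (\rank (D *m A)).
  exists U, <<D *m A>>%MS; split => [l|l|]; last by rewrite genmxE.
  - rewrite genmxE mul_mxdiag_mxcol -{1}(mxcolK (fun i => U i *m N i) l).
    exact: submxcol_sub.
  - by rewrite mxrank_ker mxrank_tr rU'.
pose L := kermx W'^T.
(* [L] annihilates W', so [L *m B] lies in the sum of the arms U and in the kernel
   of the sum map: this bounds the rank of that sum in the hub. *)
have LB_D : (L *m B <= D)%MS.
  have LBU l : (submxrow (L *m B) l <= U l)%MS.
    apply/sub_kermxP; rewrite -mul_submxrow -mulmxA -[submxrow B l]trmxK -trmx_mul.
    have /submxP[Y ->] := subU' l.
    by rewrite trmx_mul mulmxA mulmx_ker mul0mx.
  apply/submxP; exists (\mxrow_l (submxrow (L *m B) l *m pinvmx (U l))).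
  rewrite mul_mxrow_mxdiag -[LHS]submxrowK; apply: eq_mxrow => l.
  by rewrite mulmxKpV.
have LB_A : (L *m B <= kermx A)%MS by rewrite -defB submxMl.
have le_u' l : (u' l <= p l)%N by rewrite -rU' rank_leq_row.
have rD : (\rank D + \sum_l u' l = \sum_l p l)%N.
  rewrite rank_mxdiag -big_split /=; apply: eq_bigr => l _.
  by rewrite mxrank_ker mxrank_tr rU' subnK.
have := mxrank_mul_ker D A.
have : (\rank (L *m B) <= \rank (D :&: kermx A)%MS)%N.
  by rewrite mxrankS // sub_capmx LB_D.
rewrite mxrankMfree // mxrank_ker mxrank_tr rW'.
have := rank_leq_row A; rewrite rA.
have := rank_leq_row W'; rewrite rW'.
lia.
Qed.

(** The functional is (u; w) |-> a * sum u - s * w; for the canonical parameter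
    of (e; n), a = n and s = sum e.  Everything is written without
    subtraction. *)
Definition semistable_star p q (N : star p q) (a s : nat) : Prop :=
  (a * \sum_l p l = s * q)%N /\
  forall u w, has_substar N u w -> (a * \sum_l u l <= s * w)%N.

Definition subs_negative p q (N : star p q) (a s : nat) : Prop :=
  forall u w, has_substar N u w -> (exists l, u l != 0%N) \/ w != 0%N ->
    (a * \sum_l u l < s * w)%N.

Definition quotients_positive p q (N : star p q) (a s : nat) : Prop :=
  forall u w, has_substar N u w -> (exists l, u l != p l) \/ w != q ->
    (a * \sum_l u l + s * q < a * \sum_l p l + s * w)%N.

Lemma kernel_substar p q (N : star p q) l0 :
  has_substar N (fun l => if l == l0 then p l - \rank (N l) else 0)%N 0.
Proof.
exists (fun l => if l == l0 then kermx (N l) else 0), 0.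
split=> [l|l|]; last exact: mxrank0.
  by case: eqP => _; rewrite ?mulmx_ker ?mul0mx sub0mx.
by case: eqP => _; rewrite ?mxrank_ker ?mxrank0.
Qed.

Lemma image_substar p q (N : star p q) :
  has_substar N p (\rank (\mxcol_l N l)).
Proof.
exists (fun l => 1%:M), <<\mxcol_l N l>>%MS; split=> [l|l|].
- by rewrite mul1mx genmxE -{1}(mxcolK N l); exact: submxcol_sub.
- exact: mxrank1.
- by rewrite genmxE.
Qed.

(** The kernel of an arm is a subrepresentation without hub part, on which the
    functional is positive. *)
Lemma row_free_of_bound p q (N : star p q) a s : (0 < a)%N ->
  (forall u, has_substar N u 0 -> (exists l, u l != 0%N) ->
     (a * \sum_l u l <= s * 0)%N) ->
  forall l, row_free (N l).
Proof.
move=> a_gt0 bound l; rewrite /row_free eqn_leq rank_leq_row /= -subn_eq0.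
apply/negPn/negP => ker_neq0; have := bound _ (kernel_substar N l).
rewrite -big_mkcond big_pred1_eq muln0 leqn0 muln_eq0 (negPf ker_neq0) orbF.
rewrite eqn0Ngt a_gt0 => absurd; suff : false by [].
by apply: absurd; exists l; rewrite eqxx.
Qed.

(** The parameter (a, s) becomes (a, m a - s), which is again canonical. *)
Lemma complement_semistable p q (N : star p q) a s :
  (0 < a)%N -> (s <= m * a)%N -> semistable_star N a s ->
  (forall l, (p l <= q)%N) /\
  exists N' : star (fun l => q - p l)%N q, semistable_star N' a (m * a - s).
Proof.
move=> a_gt0 le_s [tot sub].
have freeN : forall l, row_free (N l).
  by apply: (row_free_of_bound (s := s) a_gt0) => u /sub.
have le_p l : (p l <= q)%N by rewrite -(eqP (freeN l)) rank_leq_col.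
have sum_compl : (\sum_l (q - p l) + \sum_l p l = m * q)%N.
  rewrite -big_split /= (eq_bigr (fun=> q)) ?sum_nat_const ?card_ord // => l _.
  by rewrite subnK.
split=> //; have [N' mirror] := complement_star freeN; exists N'.
split=> [|u' w' subu']; first nia.
have [u subu le_u'] := mirror _ _ subu'.
have [_ le_w'] := has_substar_leq subu'.
have le_sum : (\sum_l u' l + \sum_l p l <= m * w' + \sum_l u l)%N.
  have -> : (m * w' = \sum_(l < m) w')%N by rewrite sum_nat_const card_ord.
  by rewrite -!big_split leq_sum.
have := sub _ _ subu; nia.
Qed.

(** The parameter (a, s) becomes (s - a, s), which is again canonical.  Surjectivity
    of the sum map follows by testing semistability on its image. *)
Lemma reflect_semistable p q (N : star p q) a s :
  (0 < s)%N -> (a <= s)%N -> semistable_star N a s ->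
  (q <= \sum_l p l)%N /\
  exists N' : star p (\sum_l p l - q)%N, semistable_star N' (s - a) s.
Proof.
move=> s_gt0 le_a [tot sub].
have rN : \rank (\mxcol_l N l) = q.
  apply/eqP; rewrite eqn_leq rank_leq_col -(leq_pmul2l s_gt0) -tot.
  exact: sub (image_substar N).
have le_q : (q <= \sum_l p l)%N by rewrite -rN rank_leq_row.
split=> //; have [N' mirror] := reflect_star rN; exists N'.
split=> [|u' w' subu']; first nia.
have [w subu le_w] := mirror _ _ subu'.
have [le_u' _] := has_substar_leq subu'.
have sum_u' : (\sum_l (p l - u' l) + \sum_l u' l = \sum_l p l)%N.
  by rewrite -big_split /=; apply: eq_bigr => l _; rewrite subnK.
have := sub _ _ subu; nia.
Qed.

(** Duality exchanges subrepresentations and quotients, and changes the sign of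
    the functional. *)
Lemma complement_subs_negative p q (N : star p q) a s :
  (0 < a)%N -> (s <= m * a)%N -> subs_negative N a s ->
  (forall l, (p l <= q)%N) /\
  exists N' : star (fun l => q - p l)%N q, quotients_positive N' a (m * a - s).
Proof.
move=> a_gt0 le_s sub.
have freeN : forall l, row_free (N l).
  by apply: (row_free_of_bound (s := s) a_gt0) => u /sub bound u_neq0;
     apply/ltnW/bound; left.
have le_p l : (p l <= q)%N by rewrite -(eqP (freeN l)) rank_leq_col.
have sum_compl : (\sum_l (q - p l) + \sum_l p l = m * q)%N.
  rewrite -big_split /= (eq_bigr (fun=> q)) ?sum_nat_const ?card_ord // => l _.
  by rewrite subnK.
split=> //; have [N' mirror] := complement_star freeN; exists N'.
move=> u' w' subu' neq_u'.
have [u subu le_u'] := mirror _ _ subu'.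
have [le_u'q le_w'] := has_substar_leq subu'.
have le_sum : (\sum_l u' l + \sum_l p l <= m * w' + \sum_l u l)%N.
  have -> : (m * w' = \sum_(l < m) w')%N by rewrite sum_nat_const card_ord.
  by rewrite -!big_split leq_sum.
have [u0|/existsNP[l /eqP ul]] := pselect (forall l, u l = 0%N); last first.
  by have := sub _ _ subu (or_introl (ex_intro _ l ul)); nia.
have [w'q|w'q] := eqVneq w' q; last first.
  have w'_neq : (q - w' != 0)%N by lia.
  by have := sub _ _ subu (or_intror w'_neq); nia.
case: neq_u' => [[l0 neq_l0]|]; last by rewrite w'q eqxx.
rewrite w'q ltn_add2r ltn_pmul2l // (bigD1 l0) //= [ltnRHS](bigD1 l0) //=.
by rewrite -addSn leq_add ?ltn_neqAle ?neq_l0 ?le_u'q // leq_sum.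
Qed.

Lemma reflect_quotients_positive p q (N : star p q) a s :
  (0 < s)%N -> (a <= s)%N -> quotients_positive N a s ->
  (q <= \sum_l p l)%N /\
  exists N' : star p (\sum_l p l - q)%N, subs_negative N' (s - a) s.
Proof.
move=> s_gt0 le_a quo.
have rN : \rank (\mxcol_l N l) = q.
  apply/eqP; rewrite eqn_leq rank_leq_col leqNgt; apply/negP => lt_q.
  have := quo _ _ (image_substar N) (or_intror (negbT (ltn_eqF lt_q))).
  by rewrite ltn_add2l ltn_pmul2l // ltnNge (ltnW lt_q).
have le_q : (q <= \sum_l p l)%N by rewrite -rN rank_leq_row.
split=> //; have [N' mirror] := reflect_star rN; exists N'.
move=> u' w' subu' neq_u'.
have [w subu le_w] := mirror _ _ subu'.
have [le_u' _] := has_substar_leq subu'.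
have sum_u' : (\sum_l (p l - u' l) + \sum_l u' l = \sum_l p l)%N.
  by rewrite -big_split /=; apply: eq_bigr => l _; rewrite subnK.
have [u0|/existsNP[l /eqP ul]] := pselect (forall l, u' l = 0%N).
  rewrite big1 // muln0 muln_gt0 s_gt0 /=.
  by case: neq_u' => [[l]|]; rewrite ?u0 // lt0n.
have neq_l : (p l - u' l)%N != p l by have := le_u' l; lia.
by have := quo _ _ subu (or_introl (ex_intro _ l neq_l)); nia.
Qed.

Lemma simple_quotients_positive p a s : (0 < a)%N ->
  quotients_positive (fun l => 0 : 'M_(p l, 0)) a s.
Proof.
move=> a_gt0 u w subu.
have [le_u] := has_substar_leq subu; rewrite leqn0 => /eqP w0.
case=> [[l0 neq_l0]|]; last by rewrite w0.
rewrite w0 ltn_add2r ltn_pmul2l // (bigD1 l0) //= [ltnRHS](bigD1 l0) //=.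
by rewrite -addSn leq_add ?ltn_neqAle ?neq_l0 ?le_u // leq_sum.
Qed.

End Stars.

(** * Dimension vectors of stars and walls *)

Section Vectors.
Variable m : nat.

(** Integer entries make C and S involutions without side conditions; the vectors
    that occur turn out to be non-negative. *)
Definition vec : Type := {ffun option 'I_m -> int}.
Implicit Types (x y d : vec).

Definition arms x : int := \sum_l x (Some l).

(** The Euler form of the subspace quiver. *)
Definition star_form x y : int :=
  \sum_l x (Some l) * y (Some l) + x None * y None - arms x * y None.

(** The canonical stability parameter of [d], evaluated at [x]. *)
Definition weight d x : int := d None * arms x - arms d * x None.

Definition flip_arms x : vec :=
  [ffun v => if v is Some _ then x None - x v else x None].

Definition flip_hub x : vec :=
  [ffun v => if v is Some _ then x v else arms x - x None].

Lemma armsB x y : arms (x - y) = arms x - arms y.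
Proof. by rewrite /arms -sumrB; apply: eq_bigr => l _; rewrite !ffunE. Qed.

Lemma arms_nat x (p : 'I_m -> nat) : (forall l, x (Some l) = (p l)%:Z) ->
  arms x = (\sum_l p l)%N%:Z.
Proof.
by move=> xp; rewrite -natz natr_sum; apply: eq_bigr => l _; rewrite xp natz.
Qed.

Lemma arms_flip_arms x : arms (flip_arms x) = x None *+ m - arms x.
Proof.
rewrite /arms; under eq_bigr do rewrite ffunE.
by rewrite sumrB sumr_const card_ord.
Qed.

Lemma arms_flip_hub x : arms (flip_hub x) = arms x.
Proof. by apply: eq_bigr => l _; rewrite ffunE. Qed.

Lemma flip_armsK : involutive flip_arms.
Proof. by move=> x; apply/ffunP => -[l|]; rewrite !ffunE ?subKr. Qed.

Lemma flip_hubK : involutive flip_hub.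
Proof. by move=> x; apply/ffunP => -[l|]; rewrite !ffunE ?arms_flip_hub ?subKr. Qed.

Lemma flip_armsB x y : flip_arms (x - y) = flip_arms x - flip_arms y.
Proof. by apply/ffunP => -[l|]; rewrite !ffunE //; ring. Qed.

Lemma flip_hubB x y : flip_hub (x - y) = flip_hub x - flip_hub y.
Proof. by apply/ffunP => -[l|]; rewrite !ffunE ?armsB //; ring. Qed.

Lemma star_formBl x y z : star_form (x - y) z = star_form x z - star_form y z.
Proof.
rewrite /star_form armsB !ffunE.
under eq_bigr do rewrite !ffunE mulrBl.
by rewrite sumrB; ring.
Qed.

Lemma star_formBr x y z : star_form z (x - y) = star_form z x - star_form z y.
Proof.
rewrite /star_form !ffunE.
under eq_bigr do rewrite !ffunE mulrBr.
by rewrite sumrB; ring.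
Qed.

(** The flip of all arms is contravariant, hence the exchange of arguments; the
    same holds for [star_form_flip_hub]. *)
Lemma star_form_flip_arms x y :
  star_form (flip_arms x) (flip_arms y) = star_form y x.
Proof.
rewrite /star_form arms_flip_arms !ffunE.
transitivity (\sum_l (x None * y None - x None * y (Some l)
                      - y None * x (Some l) + y (Some l) * x (Some l))
              + x None * y None - (x None *+ m - arms x) * y None).
  by congr (_ + _ - _); apply: eq_bigr => l _; rewrite !ffunE; ring.
rewrite big_split /= !sumrB -!mulr_sumr sumr_const card_ord -/(arms x) -/(arms y).
by ring.
Qed.

Lemma star_form_flip_hub x y :
  star_form (flip_hub x) (flip_hub y) = star_form y x.
Proof.
rewrite /star_form arms_flip_hub !ffunE.
under eq_bigr do rewrite !ffunE mulrC.
by rewrite -/(arms y); ring.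
Qed.

Lemma weight_flip_arms d x :
  weight (flip_arms d) (flip_arms x) = - weight d x.
Proof. by rewrite /weight !arms_flip_arms !ffunE; ring. Qed.

Lemma weight_flip_hub d x : weight (flip_hub d) (flip_hub x) = - weight d x.
Proof. by rewrite /weight !arms_flip_hub !ffunE; ring. Qed.

Inductive dihedral_orbit x : vec -> Prop :=
| orbit_refl : dihedral_orbit x x
| orbit_flip_arms y : dihedral_orbit x y -> dihedral_orbit x (flip_arms y)
| orbit_flip_hub y : dihedral_orbit x y -> dihedral_orbit x (flip_hub y).

Lemma orbit_trans x y z : dihedral_orbit x y -> dihedral_orbit y z -> dihedral_orbit x z.
Proof.
move=> xy; elim=> [|{}z _ IH|{}z _ IH] //.
  exact: orbit_flip_arms.
exact: orbit_flip_hub.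
Qed.

Lemma orbit_sym x y : dihedral_orbit x y -> dihedral_orbit y x.
Proof.
elim=> [|z _ IH|z _ IH]; first exact: orbit_refl.
  apply: orbit_trans IH; rewrite -{2}(flip_armsK z).
  exact/orbit_flip_arms/orbit_refl.
apply: orbit_trans IH; rewrite -{2}(flip_hubK z).
exact/orbit_flip_hub/orbit_refl.
Qed.

Lemma orbit_form x y : dihedral_orbit x y -> star_form y y = star_form x x.
Proof.
by elim=> // z _ <-; rewrite (star_form_flip_arms, star_form_flip_hub).
Qed.

(** Writing the form as a sum of squares minus (hub) * (arms), a negative value
    forces both factors to have the same sign.  The last two inequalities are
    this remark applied to [flip_hub x] and [flip_arms x]. *)
Lemma negative_form_positive x : 0 <= x None -> star_form x x < 0 ->
  [/\ 0 < x None, 0 < arms x, x None < arms x & arms x < x None *+ m].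
Proof.
move=> x0_ge0 neg.
have sq_ge0 y : 0 <= \sum_l y (Some l) * y (Some l).
  by apply: sumr_ge0 => l _; rewrite -expr2 sqr_ge0.
have pos y : star_form y y < 0 -> 0 <= y None -> 0 < y None /\ 0 < arms y.
  by rewrite /star_form; have := sq_ge0 y; nia.
have [x0_gt0 arms_gt0] := pos x neg x0_ge0.
split=> //; last first.
  have := pos (flip_arms x); rewrite star_form_flip_arms arms_flip_arms ffunE.
  by move=> /(_ neg x0_ge0)[_]; rewrite subr_gt0.
have := star_form_flip_hub x x; have := sq_ge0 (flip_hub x).
by rewrite /star_form arms_flip_hub !ffunE; move: neg; rewrite /star_form; nia.
Qed.

End Vectors.

Section Walls.
Variables (F : fieldType) (m : nat).
Implicit Types (x y : vec m).

(** The counterpart of [in_proper_wall] for the canonical parameter, in a form on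
    which C and S act. *)
Definition on_wall x : Prop :=
  exists (p p' : 'I_m -> nat) (q q' a s : nat)
         (N : star F p q) (N' : star F p' q'),
    [/\ (0 < q)%N /\ (0 < q')%N,
        forall l, x (Some l) = (p l + p' l)%:Z,
        x None = (q + q')%:Z,
        x None = a%:Z /\ arms x = s%:Z
      & semistable_star N a s /\ semistable_star N' a s].

Lemma on_wall_flip_arms x : star_form x x < 0 -> on_wall x ->
  on_wall (flip_arms x).
Proof.
move=> neg [p [p' [q [q' [a [s [N [N' [[q_gt0 q'_gt0] xS xN [xa xs] [ss ss']]]]]]]]]].
have [|x0 sx _ lt_s] := negative_form_positive _ neg; first by rewrite xN.
have a_gt0 : (0 < a)%N by lia.
have le_s : (s <= m * a)%N by move: lt_s; rewrite xa xs -mulr_natr; lia.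
have [le_p [M ssM]] := complement_semistable a_gt0 le_s ss.
have [le_p' [M' ssM']] := complement_semistable a_gt0 le_s ss'.
exists (fun l => q - p l)%N, (fun l => q' - p' l)%N, q, q', a, (m * a - s)%N, M, M'.
split=> //.
- by move=> l; rewrite !ffunE xS xN; have := le_p l; have := le_p' l; lia.
- by rewrite ffunE.
- by rewrite arms_flip_arms ffunE xa xs -mulr_natr; split=> //; lia.
Qed.

Lemma on_wall_flip_hub x : star_form x x < 0 -> on_wall x -> on_wall (flip_hub x).
Proof.
move=> neg [p [p' [q [q' [a [s [N [N' [[q_gt0 q'_gt0] xS xN [xa xs] [ss ss']]]]]]]]]].
have [|x0 sx lt_a _] := negative_form_positive _ neg; first by rewrite xN.
have s_gt0 : (0 < s)%N by lia.
have lt_as : (a < s)%N by lia.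
have [le_q [M ssM]] := reflect_semistable s_gt0 (ltnW lt_as) ss.
have [le_q' [M' ssM']] := reflect_semistable s_gt0 (ltnW lt_as) ss'.
have tot := ss.1; have tot' := ss'.1.
have sE : (s = \sum_l p l + \sum_l p' l)%N.
  rewrite -big_split /=; apply/eqP; rewrite -eqz_nat -xs; apply/eqP.
  exact: arms_nat.
exists p, p', (\sum_l p l - q)%N, (\sum_l p' l - q')%N, (s - a)%N, s, M, M'.
split.
- by split; nia.
- by move=> l; rewrite ffunE xS.
- by rewrite ffunE xs xN; lia.
- by rewrite arms_flip_hub ffunE xa xs; split=> //; lia.
- by [].
Qed.

Lemma on_wall_orbit x y : dihedral_orbit x y -> star_form x x < 0 -> on_wall x -> on_wall y.
Proof.
move=> xy neg wall_x; elim: xy => [|z xz wall_z|z xz wall_z] //.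
  by apply: on_wall_flip_arms; rewrite // (orbit_form xz).
by apply: on_wall_flip_hub; rewrite // (orbit_form xz).
Qed.

Lemma exists_subset_card (I : finType) (X : {set I}) k :
  (k <= #|X|)%N -> exists2 Y : {set I}, Y \subset X & #|Y| = k.
Proof.
move=> le_k; exists [set i in take k (enum X)].
  by apply/fintype.subsetP => i; rewrite inE => /mem_take; rewrite mem_enum.
rewrite cardsE (card_uniqP _) ?take_uniq ?enum_uniq //.
by rewrite size_take_min -cardE (minn_idPl le_k).
Qed.

Lemma sum_indicator (X : {set 'I_m}) c :
  (\sum_l (l \in X) * c = #|X| * c)%N.
Proof.
rewrite -big_distrl -sum1_card [in RHS]big_mkcond /=.
by congr (_ * _)%N; apply: eq_bigr => l _; case: ifP.
Qed.

(** A line at the hub, equal to the arms in [B] and zero on the others. *)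
Lemma indicator_semistable (B : {set 'I_m}) :
  semistable_star (fun l => const_mx 1 : 'M[F]_(l \in B, 1%N)) 3 (3 * #|B|).
Proof.
split=> [|u w [U [W [sub rU rW]]]].
  by rewrite muln1 -[#|B|]muln1 -sum_indicator; under [in RHS]eq_bigr do rewrite muln1.
have le_u l : (u l <= (l \in B) * w)%N.
  rewrite -rU -rW.
  have free : row_free (const_mx 1 : 'M[F]_(l \in B, 1%N)).
    case: (l \in B); last by rewrite /row_free (flatmx0 (const_mx 1)) mxrank0.
    rewrite /row_free rank_rV; apply/eqP; congr nat_of_bool.
    by apply/rV0Pn; exists 0; rewrite mxE oner_eq0.
  rewrite -(mxrankMfree _ free); move: (U l) (sub l).
  case: (l \in B) => Ul subl; first by rewrite mul1n mxrankS.
  by rewrite mul0n leqn0 mxrank_eq0 [Ul]flatmx0 mul0mx.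
by rewrite -mulnA leq_mul2l /= -sum_indicator leq_sum.
Qed.


Section TwoLines.
Variables (f : 'I_m -> nat) (g : 'I_m -> nat).
Hypothesis fg_le2 : forall l, (g l + f l <= 2)%N.

(** The plane F^2 with arm l spanned by the f l basis vectors that start at the
    index g l: the zero space, one of the two coordinate lines, or the plane. *)
Definition coordinate_line (c : nat) : 'rV[F]_2 := delta_mx 0 (inord c).

Definition coordinate_star : star F f 2 :=
  fun l => \matrix_(i, j) (val j == g l + i)%N%:R.

Lemma coordinate_star_free l : row_free (coordinate_star l).
Proof.
apply/row_freeP; exists (coordinate_star l)^T; apply/matrixP => i i'.
have lt_i : (g l + i < 2)%N by have := ltn_ord i; have := fg_le2 l; lia.
rewrite !mxE (bigD1 (Ordinal lt_i)) //= big1 => [|j neq_j].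
  by rewrite !mxE /= eqxx mul1r addr0 eqn_add2l.
by rewrite !mxE -(inj_eq val_inj) /= in neq_j *; rewrite (negPf neq_j) mul0r.
Qed.

Lemma coordinate_star_line l : f l = 1%N ->
  (coordinate_star l <= coordinate_line (g l))%MS.
Proof.
move=> fl; apply/row_subP => i.
suff -> : row i (coordinate_star l) = coordinate_line (g l) by [].
have lt_g : (g l < 2)%N by have := fg_le2 l; lia.
have i0 : i = 0%N :> nat by have := ltn_ord i; rewrite [X in (_ < X)%N]fl; lia.
by apply/rowP => j; rewrite !mxE i0 addn0 eqxx /= -[j == _](inj_eq val_inj) /= inordK.
Qed.

Lemma two_lines_independent (W : 'M[F]_2) :
  (\rank (W :&: coordinate_line 0)%MS
   + \rank (W :&: coordinate_line 1)%MS <= \rank W)%N.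
Proof.
set L0 := coordinate_line 0; set L1 := coordinate_line 1.
have disj : (L0 :&: L1)%MS = 0.
  apply/eqP; rewrite -submx0; apply/rV_subP => v.
  rewrite sub_capmx => /andP[/sub_rVP[a ->] /sub_rVP[b]].
  move/rowP/(_ (inord 0)); rewrite !mxE !eqxx -(inj_eq val_inj) /= !inordK //=.
  by rewrite mulr1 mulr0 => ->; rewrite scale0r sub0mx.
rewrite -mxrank_disjoint_sum; first by rewrite mxrankS // addsmx_sub !capmxSl.
apply/eqP; rewrite -submx0 -disj sub_capmx.
by rewrite (submx_trans (capmxSl _ _) (capmxSr _ _)) (submx_trans (capmxSr _ _) (capmxSr _ _)).
Qed.

(** The two numbers are the dimensions of the intersections of the hub part with
    the two coordinate lines; these lines are independent. *)
Lemma coordinate_substar u w : has_substar coordinate_star u w ->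
  exists2 r : nat * nat, (r.1 + r.2 <= w)%N
  & forall l, (u l <= (f l == 2) * w + (f l == 1) * (if g l == 0 then r.1 else r.2))%N.
Proof.
move=> [U [W [sub rU rW]]].
exists (\rank (W :&: coordinate_line 0)%MS,
        \rank (W :&: coordinate_line 1)%MS).
  by rewrite -rW two_lines_independent.
move=> l; rewrite -rU -rW -(mxrankMfree _ (coordinate_star_free l)) /=.
have [fl|fl] := eqVneq (f l) 1%N.
  rewrite [in leqRHS]fl mul0n mul1n add0n.
  have [gl|gl] : g l = 0%N \/ g l = 1%N by have := fg_le2 l; lia.
    rewrite gl mxrankS // sub_capmx sub /=.
    apply: submx_trans (submxMl _ _) _.
    by have := coordinate_star_line fl; rewrite gl.
  rewrite gl mxrankS // sub_capmx sub /=.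
  apply: submx_trans (submxMl _ _) _.
  by have := coordinate_star_line fl; rewrite gl.
have [fl2|fl2] := eqVneq (f l) 2; first by rewrite mul1n (leq_trans (mxrankS (sub l))) ?leq_addr.
have fl0 : f l = 0%N by have := fg_le2 l; lia.
by have := rank_leq_row (U l *m coordinate_star l); rewrite [in leqRHS]fl0; lia.
Qed.

End TwoLines.

(** Choose k arms for the line; the rest has dimensions 0, 1, 2 with sum 2k, so an
    even number of arms are lines in the plane.  Splitting them evenly between
    the two coordinate lines makes the plane semistable. *)
Lemma line_plane_wall x (xn : 'I_m -> nat) k :
  x None = 3 -> (forall l, x (Some l) = (xn l)%:Z) ->
  (forall l, xn l = 1%N \/ xn l = 2%N) -> (\sum_l xn l = 3 * k)%N -> (0 < k)%N ->
  on_wall x.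
Proof.
move=> x0 xE xn12 sum_x k_gt0.
have le_k : (k <= #|[set: 'I_m]|)%N.
  rewrite cardsT card_ord -(leq_pmul2l (isT : 0 < 3)%N) -sum_x.
  apply: (@leq_trans (\sum_(l < m) 2)); last by rewrite sum_nat_const card_ord; lia.
  by apply: leq_sum => l _; case: (xn12 l) => ->.
have [B _ cardB] := exists_subset_card le_k.
pose f l := (xn l - (l \in B))%N.
have fE l : (f l + (l \in B) = xn l)%N.
  by rewrite /f; case: (xn12 l) => ->; case: (l \in B).
have sum_f : (\sum_l f l = 2 * k)%N.
  have := sum_indicator B 1; rewrite muln1 cardB.
  have : (\sum_l f l + \sum_l (l \in B) * 1 = 3 * k)%N.
    by rewrite -big_split -sum_x /=; apply: eq_bigr => l _; rewrite muln1 fE.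
  lia.
(* The arms that are lines in the plane, and those that fill it. *)
pose O := [set l | f l == 1%N]; pose T := [set l | f l == 2%N].
have cardOT : (#|O| + 2 * #|T| = 2 * k)%N.
  rewrite -sum_f -[#|O|]muln1 [(2 * _)%N]mulnC -!sum_indicator -big_split /=.
  apply: eq_bigr => l _; rewrite !inE.
  by have := fE l; case: (xn12 l) => ->; case: (l \in B); case: (f l) => [|[|[|]]].
have [|O0 sub_O card_O0] := @exists_subset_card _ O (k - #|T|)%N; first lia.
pose g l := (l \in O :\: O0 : nat).
have fg_le2 l : (g l + f l <= 2)%N.
  by rewrite /g !inE; have := fE l; case: (l \in O0); case: (xn12 l) => ->; lia.
exists (fun l => l \in B : nat), f, 1%N, 2%N, 3%N, (3 * k)%N.
exists (fun l => const_mx 1), (coordinate_star f g); split=> //.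
- by move=> l; rewrite xE -fE addnC.
- by split=> //; rewrite (arms_nat xE) sum_x.
split; first by rewrite -cardB; apply: indicator_semistable.
split=> [|u w /(coordinate_substar fg_le2)[[r0 r1] /= le_w le_u]]; first lia.
rewrite -mulnA leq_mul2l /=.
have cardO1 : #|O :\: O0| = (k - #|T|)%N.
  by rewrite cardsD (finset.setIidPr sub_O); lia.
apply: (@leq_trans (#|T| * w + #|O0| * r0 + #|O :\: O0| * r1)).
  rewrite -!sum_indicator -!big_split /=; apply: leq_sum => l _.
  apply: leq_trans (le_u l) _; rewrite -addnA [l \in T]inE leq_add2l /g !inE.
  case: (boolP (l \in O0)) => [/(fintype.subsetP sub_O)|_]; rewrite ?inE.
    by move=> ->; rewrite /= !mul1n leq_addr.
  by case: (f l == 1%N); rewrite /= ?mul1n ?mul0n ?addn0.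
rewrite card_O0 cardO1; have : (#|T| <= k)%N by lia.
nia.
Qed.

End Walls.

(** * Representations of the subspace quiver *)

Section EulerForm.
Variables (V A : finType).
Implicit Types (Q : quiver V A) (x y : {ffun V -> rat}).

Lemma euler_basis_right Q x v :
  euler Q x (basis_vec v) = x v - \sum_a x (src Q a) * (tgt Q a == v)%:R.
Proof.
rewrite /euler; congr (_ - _); last by apply: eq_bigr => a _; rewrite ffunE.
rewrite (bigD1 v) //= ffunE eqxx mulr1 big1 ?addr0 // => u /negPf neq_u.
by rewrite ffunE neq_u mulr0.
Qed.

Lemma euler_basis_left Q x v :
  euler Q (basis_vec v) x = x v - \sum_a (src Q a == v)%:R * x (tgt Q a).
Proof.
rewrite /euler; congr (_ - _); last by apply: eq_bigr => a _; rewrite ffunE.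
rewrite (bigD1 v) //= ffunE eqxx mul1r big1 ?addr0 // => u /negPf neq_u.
by rewrite ffunE neq_u mul0r.
Qed.

Lemma sum_indicatorl (v : V) x : \sum_u (v == u)%:R * x u = x v.
Proof.
rewrite (bigD1 v) //= eqxx mul1r big1 ?addr0 // => u.
by rewrite eq_sym => /negPf ->; rewrite mul0r.
Qed.

Lemma stab_eval_left Q x y : stab_eval (euler_left Q x) y = euler Q x y.
Proof.
rewrite /stab_eval /euler; under eq_bigr do rewrite ffunE euler_basis_right mulrBl.
rewrite sumrB; congr (_ - _); under eq_bigr do rewrite mulr_suml.
rewrite exchange_big; apply: eq_bigr => a _ /=.
under eq_bigr do rewrite -mulrA.
by rewrite -mulr_sumr sum_indicatorl.
Qed.

Lemma stab_eval_right Q x y : stab_eval (euler_right Q x) y = euler Q y x.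
Proof.
rewrite /stab_eval /euler; under eq_bigr do rewrite ffunE euler_basis_left mulrBl.
rewrite sumrB; congr (_ - _).
  by apply: eq_bigr => u _; rewrite mulrC.
under eq_bigr do rewrite mulr_suml.
rewrite exchange_big; apply: eq_bigr => a _ /=.
under eq_bigr do rewrite mulrAC.
by rewrite -mulr_suml sum_indicatorl.
Qed.

Lemma stab_evalB Theta x y :
  stab_eval Theta (x - y) = stab_eval Theta x - stab_eval Theta y.
Proof.
rewrite /stab_eval -sumrB; apply: eq_bigr => v _.
by rewrite !ffunE mulrBr.
Qed.

Lemma stab_eval_can Q (d : {ffun V -> nat}) x :
  stab_eval (theta_can Q d) x = euler Q (qdim d) x - euler Q x (qdim d).
Proof.
rewrite -stab_eval_left -stab_eval_right /stab_eval -sumrB.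
by apply: eq_bigr => v _; rewrite !ffunE mulrBl.
Qed.

End EulerForm.

Section SubspaceQuiver.
Variable m : nat.
Implicit Types (x y : vec m) (d e : {ffun option 'I_m -> nat}).

Definition zdim d : vec m := [ffun v => (d v)%:Z].

Lemma arms_zdim d : arms (zdim d) = (\sum_l d (Some l))%N%:Z.
Proof. by apply: arms_nat => l; rewrite ffunE. Qed.

Definition qvec x : {ffun option 'I_m -> rat} := [ffun v => (x v)%:~R].

Lemma qdim_zdim d : qdim d = qvec (zdim d).
Proof. by apply/ffunP => v; rewrite !ffunE. Qed.

Lemma qvecB x y : qvec (x - y) = qvec x - qvec y.
Proof. by apply/ffunP => v; rewrite !ffunE intrB. Qed.

Lemma sum_option (R : nmodType) (f : option 'I_m -> R) :
  \sum_v f v = \sum_l f (Some l) + f None.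
Proof.
rewrite (bigD1 None) //= addrC; congr (_ + _).
rewrite (reindex_omap Some id) /=; first by apply: eq_bigl => l; rewrite eqxx.
by case.
Qed.

Lemma euler_subspace x y :
  euler (subspace_quiver m) (qvec x) (qvec y) = (star_form x y)%:~R.
Proof.
rewrite /euler /star_form sum_option intrB intrD intrM.
congr (_ + _ - _).
- rewrite rmorph_sum; apply: eq_bigr => l _; by rewrite !ffunE -intrM.
- by rewrite !ffunE.
- rewrite intrM rmorph_sum /= mulr_suml; apply: eq_bigr => l _.
  by rewrite !ffunE.
Qed.

Lemma stab_eval_subspace d x :
  stab_eval (theta_can (subspace_quiver m) d) (qvec x) =
  (weight (zdim d) x)%:~R.
Proof.
rewrite stab_eval_can qdim_zdim !euler_subspace -intrB /weight /star_form.
congr intr; under eq_bigr do rewrite mulrC.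
by ring.
Qed.

Lemma is_stab_subspace d : is_stab d (theta_can (subspace_quiver m) d).
Proof.
by rewrite /is_stab qdim_zdim stab_eval_subspace /weight mulrC subrr.
Qed.

End SubspaceQuiver.

Section StarReps.
Variables (F : fieldType) (m : nat).
Implicit Types (d e : {ffun option 'I_m -> nat}).
Notation Q := (subspace_quiver m).

(** The source and target of an arrow are computed by finite functions, so the
    matrices of a representation match those of a star only up to a cast. *)
Lemma subrep_castmx d (U : subspaces F d) u v u' v' (eu : u = u') (ev : v = v')
    (M : 'M_(d u, d v)) :
  (U u' *m castmx (congr1 d eu, congr1 d ev) M <= U v')%MS =
  (U u *m M <= U v)%MS.
Proof. by case: _ / eu; case: _ / ev; rewrite castmx_id. Qed.

Lemma star_rep e (N : star F (fun l => e (Some l)) (e None)) :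
  exists M : rep F Q e, forall U : subspaces F e,
    is_subrep M U <-> forall l, (U (Some l) *m N l <= U None)%MS.
Proof.
have eS l : Some l = src Q l by rewrite ffunE.
have eT l : None = tgt Q l by rewrite ffunE.
exists (fun l => castmx (congr1 e (eS l), congr1 e (eT l)) (N l)) => U.
by split=> subU l; have := subU l; rewrite subrep_castmx.
Qed.

Lemma substar_of_subspaces e (N : star F (fun l => e (Some l)) (e None))
    (U : subspaces F e) :
  (forall l, (U (Some l) *m N l <= U None)%MS) ->
  has_substar N (fun l => dim_of U (Some l)) (dim_of U None).
Proof.
move=> subU; exists (fun l => U (Some l)), (U None).
by split=> // [l|]; rewrite ffunE.
Qed.

Definition star_dim (p : 'I_m -> nat) (q : nat) : {ffun option 'I_m -> nat} :=
  [ffun v => if v is Some l then p l else q].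

Lemma rep_of_star p q (N : star F p q) :
  exists M : rep F Q (star_dim p q), forall U, is_subrep M U ->
    has_substar N (fun l => dim_of U (Some l)) (dim_of U None).
Proof.
have dS : (fun l => star_dim p q (Some l)) = p by apply: funext => l; rewrite ffunE.
have dN : star_dim p q None = q by rewrite ffunE.
suff : forall p' q' (N' : star F p' q'),
    (fun l => star_dim p q (Some l)) = p' -> star_dim p q None = q' ->
    exists M : rep F Q (star_dim p q), forall U, is_subrep M U ->
      has_substar N' (fun l => dim_of U (Some l)) (dim_of U None).
  exact.
move=> p' q' N' eS eN; case: _ / eS N'; case: _ / eN => N'.
have [M ME] := star_rep N'; exists M => U /ME; exact: substar_of_subspaces.
Qed.

Lemma weight_nat d e a s : d None = a -> (\sum_l d (Some l))%N = s ->
  weight (zdim d) (zdim e) =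
  (a * \sum_l e (Some l))%N%:Z - (s * e None)%N%:Z.
Proof.
move=> <- <-; rewrite /weight !ffunE.
by rewrite !arms_zdim.
Qed.

Lemma semistable_of_star d p q (N : star F p q) :
  semistable_star N (d None) (\sum_l d (Some l)) ->
  exists M : rep F Q (star_dim p q), semistable (theta_can Q d) M.
Proof.
move=> [tot sub]; have [M ME] := rep_of_star N; exists M; split.
  rewrite /is_stab qdim_zdim stab_eval_subspace (weight_nat _ erefl erefl).
  rewrite [star_dim p q None]ffunE -tot.
  by under eq_bigr do rewrite ffunE; rewrite subrr.
move=> U /ME/sub le_U _ _.
rewrite qdim_zdim stab_eval_subspace (weight_nat _ erefl erefl).
by rewrite lerz0 subr_le0 lez_nat.
Qed.

Lemma in_proper_wall_of_on_wall d : on_wall F (zdim d) ->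
  in_proper_wall F Q d (theta_can Q d).
Proof.
move=> [p [p' [q [q' [a [s [N [N' [[q_gt0 q'_gt0] dS dN [da ds] [ss ss']]]]]]]]]].
split; first exact: is_stab_subspace.
have dSE l : d (Some l) = (p l + p' l)%N by have := dS l; rewrite ffunE => -[].
have dNE : d None = (q + q')%N by have := dN; rewrite ffunE => -[].
have aE : d None = a by move: da; rewrite ffunE => -[].
have sE : (\sum_l d (Some l))%N = s.
  by apply/eqP; rewrite -eqz_nat -ds arms_zdim.
have le_d : subdim (star_dim p q) d.
  by case=> [l|]; rewrite ffunE ?dSE ?dNE leq_addr.
exists (star_dim p q); split.
- split=> //.
    by apply/eqP => /ffunP/(_ None); rewrite !ffunE; lia.
  by apply/eqP => /ffunP/(_ None); rewrite !ffunE dNE; lia.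
- rewrite qdim_zdim stab_eval_subspace (weight_nat _ aE sE).
  rewrite [star_dim p q None]ffunE -ss.1.
  by under eq_bigr do rewrite ffunE; rewrite subrr.
- by apply: (semistable_of_star (N := N)); rewrite aE sE.
have -> : compl_dim d (star_dim p q) = star_dim p' q'.
  by apply/ffunP => -[l|]; rewrite !ffunE ?dSE ?dNE addKn.
by apply: (semistable_of_star (N := N')); rewrite aE sE.
Qed.

End StarReps.

Section Morphisms.
Variables (F : fieldType) (V A : finType) (Q : quiver V A).
Variables (d1 d2 : {ffun V -> nat}) (M1 : rep F Q d1) (M2 : rep F Q d2).
Variables (phi : forall v, 'M[F]_(d1 v, d2 v)).

Definition kernel : subspaces F d1 := fun v => kermx (phi v).
Definition image : subspaces F d2 := fun v => <<phi v>>%MS.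

Hypothesis morphism_phi : is_morphism M1 M2 phi.

Lemma kernel_subrep : is_subrep M1 kernel.
Proof.
by move=> a; apply/sub_kermxP; rewrite -mulmxA morphism_phi mulmxA mulmx_ker mul0mx.
Qed.

Lemma image_subrep : is_subrep M2 image.
Proof.
move=> a; rewrite /image genmxE.
have /eqmxMr-/(_ _ (M2 a)) -> := genmxE (phi (src Q a)).
by rewrite -morphism_phi submxMl.
Qed.

Lemma kernel_image_dim :
  qdim d1 = qdim (dim_of kernel) + qdim (dim_of image).
Proof.
apply/ffunP => v; rewrite !ffunE genmxE mxrank_ker -natrD subnK //.
exact: rank_leq_row.
Qed.

Lemma image_neq0 v : phi v != 0 -> dim_of image != 0.
Proof.
move=> phiv; apply/eqP => /ffunP/(_ v); rewrite !ffunE genmxE => /eqP.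
by rewrite mxrank_eq0 (negPf phiv).
Qed.

Lemma kernel_proper v : phi v != 0 -> dim_of kernel != d1.
Proof.
rewrite -mxrank_eq0 -lt0n => phiv; apply/eqP => /ffunP/(_ v).
rewrite !ffunE mxrank_ker => /eqP; rewrite -[eqbRHS]subn0 eqn_sub2lE //.
  by rewrite eqn0Ngt phiv.
exact: rank_leq_row.
Qed.

End Morphisms.

Section Unstable.
Variables (F : fieldType) (V A : finType) (Q : quiver V A).
Variables (b d : {ffun V -> nat}) (E : rep F Q b) (Theta : {ffun V -> rat}).
Hypothesis stab_d : is_stab d Theta.

(** The image of the morphism is a quotient of [E] and a subrepresentation of
    [M]. *)
Lemma unstable_of_hom_from (M : rep F Q d) :
  (forall U, is_subrep E U -> dim_of U != b ->
     0 < stab_eval Theta (qdim b - qdim (dim_of U))) ->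
  nonzero_morphism E M -> ~ semistable Theta M.
Proof.
move=> quo [phi [morphi [v phiv]]] [_ ssM].
have := quo _ (kernel_subrep morphi) (kernel_proper phiv).
rewrite (kernel_image_dim phi) addrC addKr => pos.
have := ssM _ (image_subrep morphi) (image_neq0 phiv).
rewrite leNgt pos => neq_d; suff : false by [].
apply: neq_d; apply: contraTneq pos => ->.
by rewrite stab_d ltxx.
Qed.

(** The image of the morphism is negative, so its kernel in [M] is positive. *)
Lemma unstable_of_hom_to (M : rep F Q d) :
  (forall U, is_subrep E U -> dim_of U != 0 ->
     stab_eval Theta (qdim (dim_of U)) < 0) ->
  nonzero_morphism M E -> ~ semistable Theta M.
Proof.
move=> sub [phi [morphi [v phiv]]] [_ ssM].
have neg := sub _ (image_subrep morphi) (image_neq0 phiv).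
have pos : 0 < stab_eval Theta (qdim (dim_of (kernel phi))).
  rewrite -(addrK (qdim (dim_of (image phi))) (qdim (dim_of (kernel phi)))).
  by rewrite -kernel_image_dim stab_evalB stab_d sub0r oppr_gt0.
have := ssM _ (kernel_subrep morphi); rewrite leNgt pos => neq.
suff : false by []; apply: neq; last exact: (kernel_proper phiv).
apply: contraTneq pos => ->.
rewrite /stab_eval big1 ?ltxx // => u _.
by rewrite !ffunE mulr0.
Qed.

End Unstable.

(** When [f] vanishes identically every point lies in [Z], and a coordinate
    function takes the place of [f]. *)
Lemma unstable_divisor (F : closedFieldType) (V A : finType) (Q : quiver V A)
    (d : {ffun V -> nat}) (c : Defs.coord Q d) (f : {mpoly F[#|Defs.coord Q d|]})
    (Z : set (rep F Q d)) M0 :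
  peval f M0 = 0 -> (forall M, peval f M = 0 -> Z M) -> ~ codim_ge 2 Z.
Proof.
move=> f0 fZ; have [[M1 f1]|no_M1] := pselect (exists M1, peval f M1 != 0).
  exact: hypersurface_codim_lt2 f0 f1 fZ.
apply: (@hypersurface_codim_lt2 _ _ _ _ _ 'X_(enum_rank c) _
          (fun a => 0) (fun a => const_mx 1)).
- by rewrite /peval mevalXU enum_rankK /coord_val mxE.
- by rewrite /peval mevalXU enum_rankK /coord_val mxE oner_eq0.
by move=> M _; apply: fZ; apply: contra_notP no_M1 => /eqP; exists M.
Qed.

(** * The outward orbit of an extremal vector *)

Section Outward.
Variable m : nat.
Implicit Types (x y d b : vec m) (o : bool).

Definition bounded x : Prop := forall l, 0 <= x (Some l) <= x None.

(** The sum of the arms exceeds twice the hub, so S enlarges the hub and the orbit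
    grows from there on; arm [k], as large as the hub, is the one that
    destabilises. *)
Definition extremal x (k : 'I_m) : Prop :=
  [/\ bounded x, x (Some k) = x None, 1 <= x None & x None *+ 2 + 1 <= arms x].

Definition unit_vec (k : 'I_m) : vec m := [ffun v => (v == Some k)%:R].

(** The alternating words S, C S, S C S, ... applied to [d0] and to the basis
    vector at [k]; the boolean tells whether the last letter is S. *)
Inductive outward d0 (k : 'I_m) : bool -> vec m -> vec m -> Prop :=
| outward_start : outward d0 k true (flip_hub d0) (flip_hub (unit_vec k))
| outward_flip_arms d b : outward d0 k true d b ->
    outward d0 k false (flip_arms d) (flip_arms b)
| outward_flip_hub d b : outward d0 k false d b ->
    outward d0 k true (flip_hub d) (flip_hub b).

Lemma arms_unit k : arms (unit_vec k) = 1.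
Proof.
rewrite /arms (bigD1 k) //= ffunE eqxx big1 ?addr0 // => l neq_l.
by rewrite ffunE (inj_eq Some_inj) (negPf neq_l).
Qed.

Lemma star_form_unit k x : star_form (unit_vec k) x = x (Some k) - x None.
Proof.
rewrite /star_form arms_unit ffunE mul0r addr0 mul1r; congr (_ - _).
rewrite (bigD1 k) //= ffunE eqxx mul1r big1 ?addr0 // => l neq_l.
by rewrite ffunE (inj_eq Some_inj) (negPf neq_l) mul0r.
Qed.

Lemma bounded_hub_ge0 x : (0 < m)%N -> bounded x -> 0 <= x None.
Proof. by move=> m_gt0 /(_ (Ordinal m_gt0))/andP[/le_trans tr /tr]. Qed.

Lemma bounded_flip_arms x : bounded x -> bounded (flip_arms x).
Proof. by move=> bx l; have := bx l; rewrite !ffunE; lia. Qed.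

Lemma bounded_flip_hub x : bounded x -> x None *+ 2 <= arms x ->
  bounded (flip_hub x).
Proof. by move=> bx le l; have := bx l; rewrite !ffunE; lia. Qed.

(** The two halves of [d] satisfy the same inequalities: after S the arms sum to
    at most twice the hub, after C to at least twice the hub (this needs four
    arms), and in both cases the next letter keeps the entries between zero and
    the hub. *)
Lemma outward_bounded d0 k o d b : (4 <= m)%N -> extremal d0 k ->
  outward d0 k o d b ->
  [/\ bounded b, bounded (d - b), 1 <= b None
    & if o then arms b <= b None *+ 2 /\ arms (d - b) <= (d - b) None *+ 2
      else b None *+ 2 <= arms b /\ (d - b) None *+ 2 <= arms (d - b)].
Proof.
move=> m_ge4 [bd0 d0k d0_ge1 arms_d0].
have m_gt0 : (0 < m)%N by apply: leq_trans m_ge4.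
have arms4 x : bounded x -> arms x <= x None *+ 2 ->
    (flip_arms x) None *+ 2 <= arms (flip_arms x).
  move=> bx; rewrite arms_flip_arms ffunE.
  have x0_ge0 := bounded_hub_ge0 m_gt0 bx.
  have := ler_wpMn2l x0_ge0 m_ge4; move: (x None *+ m) => y; lia.
elim=> [|{}d {}b _ [bb bdb b_ge1 [arms_b arms_db]]|{}d {}b _ [bb bdb b_ge1 [arms_b arms_db]]].
- have d0l l : 0 <= d0 (Some l) - (l == k)%:R <= d0 None.
    have := bd0 l; have [->|_] := eqVneq l k; last by rewrite subr0.
    by rewrite d0k mulr1n; lia.
  split=> [l|l||].
  + by rewrite !ffunE arms_unit (inj_eq Some_inj); case: (l == k).
  + rewrite !ffunE arms_unit (inj_eq Some_inj); have := d0l l; lia.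
  + by rewrite ffunE arms_unit ffunE.
  + by rewrite armsB !arms_flip_hub !ffunE arms_unit subr0; lia.
- split.
  + exact: bounded_flip_arms.
  + by rewrite -flip_armsB; apply: bounded_flip_arms.
  + by rewrite ffunE.
  + by rewrite -flip_armsB; split; apply: arms4.
split.
- exact: bounded_flip_hub.
- by rewrite -flip_hubB; apply: bounded_flip_hub.
- by rewrite ffunE; lia.
- rewrite -flip_hubB !arms_flip_hub; move: (d - b) arms_db => c arms_db.
  by rewrite !ffunE !mulr2n; move: arms_b arms_db; rewrite !mulr2n => ? ?; split; lra.
Qed.

(** At the start these are e_k - n = 0 and n > 0; each letter exchanges the
    arguments of the form and changes the sign of the weight. *)
Lemma outward_forms d0 k o d b : extremal d0 k -> outward d0 k o d b ->
  [/\ star_form b b = 1,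
      (if o then star_form d b else star_form b d) = 0
    & if o then weight d b < 0 else 0 < weight d b].
Proof.
move=> [_ d0k d0_ge1 _]; elim=> [|{}d {}b _ [bb db w]|{}d {}b _ [bb bd w]].
- rewrite !star_form_flip_hub !star_form_unit weight_flip_hub d0k subrr !ffunE eqxx.
  rewrite /weight arms_unit ffunE /= mulr0 mulr1 subr0 oppr_lt0; split=> //.
  by rewrite subr0 (lt_le_trans _ d0_ge1).
- by rewrite !star_form_flip_arms weight_flip_arms; split=> //; rewrite oppr_gt0.
- by rewrite !star_form_flip_hub weight_flip_hub; split=> //; rewrite oppr_lt0.
Qed.

(** The images of the simple representation at [k] under the functors. *)
Lemma outward_star (F : fieldType) d0 k o d b : (4 <= m)%N -> extremal d0 k ->
  outward d0 k o d b ->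
  exists p q (N : star F p q) (a s : nat),
    [/\ forall l, b (Some l) = (p l)%:Z, b None = q%:Z, d None = a%:Z,
        arms d = s%:Z
      & if o then subs_negative N a s else quotients_positive N a s].
Proof.
move=> m_ge4 ext; elim=> [|{}d {}b out IH|{}d {}b out IH].
- have [bd0 d0k d0_ge1 arms_d0] := ext.
  pose a := `|d0 None|%N; pose s := `|arms d0|%N.
  have aE : d0 None = a%:Z by rewrite /a; lia.
  have sE : arms d0 = s%:Z by rewrite /s; lia.
  pose p l := (l == k : nat).
  have sum_p : (\sum_l p l)%N = 1%N.
    by rewrite (bigD1 k) //= /p eqxx big1 // => l /negPf ->.
  have a_gt0 : (0 < a)%N by lia.
  have [||_ [N sn]] :=
    reflect_quotients_positive _ _ (@simple_quotients_positive F m p a s a_gt0).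
  + by lia.
  + by lia.
  exists p, _, N, (s - a)%N, s; split=> //.
  + by move=> l; rewrite !ffunE (inj_eq Some_inj) /p; case: (l == k).
  + by rewrite ffunE arms_unit ffunE sum_p.
  + by rewrite ffunE aE sE; lia.
  + by rewrite arms_flip_hub.
- have [p [q [N [a [s [bS bN da ds sn]]]]]] := IH.
  have [bb bdb b_ge1 [arms_b arms_db]] := outward_bounded m_ge4 ext out.
  have db0 : 0 <= (d - b) None.
    by apply: bounded_hub_ge0 bdb; apply: leq_trans m_ge4.
  have a_gt0 : (0 < a)%N by move: db0 b_ge1; rewrite !ffunE da bN; lia.
  have le_s : (s <= m * a)%N.
    move: arms_b arms_db; rewrite armsB !ffunE da ds bN (arms_nat bS) !mulr2n.
    by nia.
  have [le_p [N' qp]] := complement_subs_negative a_gt0 le_s sn.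
  exists (fun l => q - p l)%N, q, N', a, (m * a - s)%N; split=> //.
  + by move=> l; rewrite !ffunE bS bN; have := le_p l; lia.
  + by rewrite ffunE.
  + by rewrite ffunE.
  + by rewrite arms_flip_arms da ds -mulr_natr; lia.
have [p [q [N [a [s [bS bN da ds qp]]]]]] := IH.
have [bb bdb b_ge1 [arms_b arms_db]] := outward_bounded m_ge4 ext out.
have db0 : 0 <= (d - b) None.
  by apply: bounded_hub_ge0 bdb; apply: leq_trans m_ge4.
have [s_gt0 le_a] : (0 < s)%N /\ (a <= s)%N.
  move: arms_b arms_db db0 b_ge1.
  by rewrite armsB !ffunE da ds bN (arms_nat bS) !mulr2n; lia.
have [le_q [N' sn]] := reflect_quotients_positive s_gt0 le_a qp.
exists p, _, N', (s - a)%N, s; split=> //.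
- by move=> l; rewrite ffunE bS.
- by rewrite ffunE (arms_nat bS) bN; lia.
- by rewrite ffunE da ds; lia.
- by rewrite arms_flip_hub.
Qed.


End Outward.

(** * Failure of ample stability *)

Section NotAmple.
Variables (F : closedFieldType) (m : nat).
Implicit Types (d : {ffun option 'I_m -> nat}) (x y b : vec m).
Notation Q := (subspace_quiver m).

Lemma dim_of_star_neq (e e' : {ffun option 'I_m -> nat}) : e != e' ->
  (exists l, e (Some l) != e' (Some l)) \/ e None != e' None.
Proof.
move=> neq; have [eqN|] := eqVneq (e None) (e' None); last by right.
left; apply: contrapT => /forallNP eqS; case/eqP: neq; apply/ffunP => -[l|//].
by apply/eqP/negPn/negP; exact: eqS.
Qed.

(** The form takes the value -1 on the pair formed by [b] and [d - b], in the order
    in which the first member has positive weight. *)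
Lemma outward_not_strongly_ample d (d0 : vec m) k o b : (4 <= m)%N -> extremal d0 k ->
  outward d0 k o (zdim d) b -> ~ strongly_amply_stable Q d (theta_can Q d).
Proof.
move=> m_ge4 ext out strong.
have [bb bdb _ _] := outward_bounded m_ge4 ext out.
have [bb1 b_d w_b] := outward_forms ext out.
have m_gt0 : (0 < m)%N by apply: leq_trans m_ge4.
have nonneg x : bounded x -> forall v, 0 <= x v.
  by move=> bx [l|]; [case/andP: (bx l) | apply: bounded_hub_ge0 bx].
have weight_dd : weight (zdim d) (zdim d) = 0 by rewrite /weight mulrC subrr.
have weightB x y : weight (zdim d) (x - y) = weight (zdim d) x - weight (zdim d) y.
  by rewrite /weight armsB !ffunE; ring.
have [c [c_ge0 dc_ge0 w_c c_dc]] : exists c : vec m, [/\ forall v, 0 <= c v,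
    forall v, 0 <= (zdim d - c) v, 0 < weight (zdim d) c
    & star_form c (zdim d - c) = -1].
  case: o out b_d w_b => out b_d w_b.
    exists (zdim d - b); rewrite subKr weightB weight_dd sub0r oppr_gt0.
    by rewrite star_formBl b_d bb1; split=> //; apply: nonneg.
  exists b; rewrite star_formBr b_d bb1.
  by split=> //; apply: nonneg.
pose e := [ffun v => `|c v|%N] : {ffun option 'I_m -> nat}.
have ze : zdim e = c by apply/ffunP => v; rewrite !ffunE gez0_abs.
have le_e : subdim e d.
  by move=> v; have := dc_ge0 v; rewrite !ffunE subr_ge0 -lez_nat gez0_abs.
have proper_e : proper_subdim e d.
  split=> //.
    apply: contraTneq w_c => e0; rewrite -ze e0 /weight arms_zdim.
    rewrite big1 => [|l _]; last by rewrite ffunE.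
    by rewrite !ffunE !mulr0 subrr ltxx.
  by apply: contraTneq w_c => ed; rewrite -ze ed weight_dd ltxx.
have := strong e proper_e.
rewrite !qdim_zdim ze -qvecB stab_eval_subspace ltr0z euler_subspace c_dc.
by move=> /(_ w_c).
Qed.

(** The unstable locus contains the hypersurface of the [M] that have a non-zero
    morphism to or from the representation of dimension [b]. *)
Lemma outward_not_ample d (d0 : vec m) k o b : (4 <= m)%N -> extremal d0 k ->
  (forall v, (0 < d v)%N) ->
  outward d0 k o (zdim d) b -> ~ amply_stable F Q d (theta_can Q d).
Proof.
move=> m_ge4 ext d_gt0 out.
have m_gt0 : (0 < m)%N by apply: leq_trans m_ge4.
have [_ _ b_ge1 arms_b] := outward_bounded m_ge4 ext out.
have [_ b_d _] := outward_forms ext out.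
have [p [q [N [a [s [bS bN da ds stab_N]]]]]] := outward_star F m_ge4 ext out.
have aE : d None = a by move: da; rewrite ffunE => -[].
have sE : (\sum_l d (Some l))%N = s by apply/eqP; rewrite -eqz_nat -ds arms_zdim.
have [E EE] := rep_of_star N.
have zb : zdim (star_dim p q) = b.
  by apply/ffunP => -[l|]; rewrite !ffunE ?bS ?bN.
have q_gt0 : (0 < q)%N by move: b_ge1; rewrite bN; lia.
pose l0 : 'I_m := Ordinal m_gt0.
have c : Defs.coord Q d.
  by exists l0; split; apply: Ordinal (d_gt0 _).
pose M0 : rep F Q d := fun a => 0.
have const_neq0 r t : (0 < r)%N -> (0 < t)%N -> const_mx 1 != 0 :> 'M[F]_(r, t).
  move=> r_gt0 t_gt0; apply/matrix0Pn; exists (Ordinal r_gt0), (Ordinal t_gt0).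
  by rewrite mxE oner_eq0.
have srcE l : src Q l = Some l by rewrite ffunE.
have tgtE l : tgt Q l = None by rewrite ffunE.
(* The zero representation is a zero of the determinant: a map supported at the
   hub, or at the arms, is a morphism to or from it. *)
case: o out arms_b b_d stab_N => out [arms_b _] b_d stab_N.
  have [f fE] : exists f : {mpoly F[#|Defs.coord Q d|]},
      forall M, peval f M = 0 <-> nonzero_morphism M E.
    by apply: hom_to_determinant; rewrite !qdim_zdim zb euler_subspace b_d.
  apply: (unstable_divisor c (f := f) (M0 := M0)).
    apply/fE; exists (fun v => if v is None then const_mx 1 else 0); split.
      move=> l; rewrite mul0mx; move: (E l); move: (src Q l) (srcE l) => v ->.
      by move=> El; rewrite mul0mx.
    by exists None; apply: const_neq0; rewrite ?d_gt0 // ffunE.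
  move=> M /fE; apply: unstable_of_hom_to; first exact: is_stab_subspace.
  move=> U /EE/stab_N neg U_neq0.
  rewrite qdim_zdim stab_eval_subspace (weight_nat _ aE sE) ltrz0 subr_lt0 ltz_nat.
  apply: neg; case: (dim_of_star_neq U_neq0) => [[l]|]; rewrite [X in _ != X]ffunE.
    by left; exists l.
  by right.
have [l1 p_gt0] : exists l, (0 < p l)%N.
  apply: contrapT => /forallNP p0; move: arms_b; rewrite bN (arms_nat bS) big1.
    lia.
  by move=> l _; have /negP := p0 l; rewrite -eqn0Ngt => /eqP.
have [f fE] : exists f : {mpoly F[#|Defs.coord Q d|]},
    forall M, peval f M = 0 <-> nonzero_morphism E M.
  by apply: hom_from_determinant; rewrite !qdim_zdim zb euler_subspace b_d.
apply: (unstable_divisor c (f := f) (M0 := M0)).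
  apply/fE; exists (fun v => if v is Some _ then const_mx 1 else 0); split.
    move=> l; rewrite mulmx0; move: (E l); move: (tgt Q l) (tgtE l) => v ->.
    by move=> El; rewrite mulmx0.
  by exists (Some l1); apply: const_neq0; rewrite ?d_gt0 // ffunE.
move=> M /fE; apply: unstable_of_hom_from; first exact: is_stab_subspace.
move=> U /EE/stab_N pos U_neq.
rewrite stab_evalB !qdim_zdim !stab_eval_subspace !(weight_nat _ aE sE).
rewrite -intrB ltr0z.
have {pos} : (a * \sum_l dim_of U (Some l) + s * q
              < a * \sum_l p l + s * dim_of U None)%N.
  apply: pos; case: (dim_of_star_neq U_neq) => [[l]|]; rewrite [X in _ != X]ffunE.
    by left; exists l.
  by right.
rewrite [star_dim p q None]ffunE; under [in X in _ -> X]eq_bigr do rewrite ffunE.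
by rewrite subr_gt0 ltrBlDr addrAC ltrBrDr -!PoszD ltz_nat.
Qed.

End NotAmple.

Section OrbitCases.
Variable m : nat.
Implicit Types (x y b : vec m).

(** The four listed vectors have arm [k] equal to zero or to the hub; from the two
    ends of this list the orbit leaves by S and never returns. *)
Lemma orbit_outward x k y : dihedral_orbit x y ->
  y \in [:: x; flip_arms x; flip_hub (flip_arms x);
            flip_arms (flip_hub (flip_arms x))] \/
  exists o b, outward x k o y b
    \/ outward (flip_arms (flip_hub (flip_arms x))) k o y b.
Proof.
elim=> [|{}y _ [y_in|[o [b out]]]|{}y _ [y_in|[o [b out]]]].
- by left; rewrite inE eqxx.
- by left; move: y_in; rewrite !inE => /or4P[]/eqP->; rewrite ?flip_armsK ?eqxx ?orbT.
- case: o out => out.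
    right; exists false, (flip_arms b).
    by case: out; [left | right]; apply: outward_flip_arms.
  have inv d0 : outward d0 k false y b -> exists b', outward d0 k true (flip_arms y) b'.
    move Eo : false => o' out'; case: out' Eo => // d b' out' _.
    by exists b'; rewrite flip_armsK.
  right; exists true; case: out => /inv[b' out]; exists b'; by [left | right].
- move: y_in; rewrite !inE => /or4P[]/eqP->.
  + by right; exists true, (flip_hub (unit_vec k)); left; apply: outward_start.
  + by left; rewrite eqxx !orbT.
  + by left; rewrite flip_hubK eqxx orbT.
  + by right; exists true, (flip_hub (unit_vec k)); right; apply: outward_start.
- case: o out => out; last first.
    right; exists true, (flip_hub b).
    by case: out; [left | right]; apply: outward_flip_hub.
  have inv d0 : outward d0 k true y b ->
      flip_hub y = d0 \/ exists b', outward d0 k false (flip_hub y) b'.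
    move Eo : true => o' out'; case: out' Eo => // [_|d b' out' _].
      by left; rewrite flip_hubK.
    by right; exists b'; rewrite flip_hubK.
  case: out => /inv[->|[b' out]].
  + by left; rewrite inE eqxx.
  + by right; exists false, b'; left.
  + by left; rewrite !inE eqxx !orbT.
  + by right; exists false, b'; right.
Qed.

Lemma extremal_opposite x k : (5 <= m)%N -> extremal x k ->
  arms x + x None *+ 2 <= x None *+ m ->
  extremal (flip_arms (flip_hub (flip_arms x))) k.
Proof.
move=> m_ge5 [bx xk x_ge1 arms_x] le_arms.
set n' : int := x None *+ m - arms x - x None.
have n'_ge : x None <= n' by move: le_arms; rewrite /n' mulr2n; lra.
have hubE : flip_arms (flip_hub (flip_arms x)) None = n'.
  by rewrite !ffunE arms_flip_arms.
have armE l : flip_arms (flip_hub (flip_arms x)) (Some l) = n' - (x None - x (Some l)).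
  by rewrite !ffunE arms_flip_arms.
split.
- by move=> l; rewrite hubE armE; have /andP[] := bx l; move=> ? ?; apply/andP; split; lra.
- by rewrite armE hubE xk subrr subr0.
- by rewrite hubE (le_trans x_ge1).
rewrite hubE !arms_flip_arms arms_flip_hub !ffunE !arms_flip_arms.
have : n' *+ 5 <= n' *+ m by apply: ler_wpMn2l m_ge5; lra.
rewrite -/n'; move: (n' *+ m) => N; rewrite /n' !mulrS !mulr0n => ?; lra.
Qed.

End OrbitCases.

(** * Admissible steps and normal forms *)

Section SinkReflection.
Variables (V A : finType) (Q : quiver V A) (i : V).
Hypothesis sink_i : is_sink Q i.
Implicit Types (x y : {ffun V -> rat}) (d : {ffun V -> nat}).

Definition incoming x : rat := \sum_(a | tgt Q a == i) x (src Q a).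

Lemma euler_sink x : euler Q x (basis_vec i) = x i - incoming x.
Proof.
rewrite euler_basis_right /incoming [in RHS]big_mkcond; congr (_ - _).
by apply: eq_bigr => a _; case: eqP; rewrite ?mulr1 ?mulr0.
Qed.

Lemma euler_from_sink x : euler Q (basis_vec i) x = x i.
Proof.
rewrite euler_basis_left big1 ?subr0 // => a _.
by rewrite (negPf (sink_i a)) mul0r.
Qed.

Lemma reflect_vecE x v :
  reflect_vec Q i x v = if v == i then incoming x - x i else x v.
Proof.
rewrite !ffunE /sym_euler euler_sink euler_from_sink.
by case: eqP => [->|_]; rewrite ?mulr1 ?mulr0; ring.
Qed.

Lemma incoming_reflect x : incoming (reflect_vec Q i x) = incoming x.
Proof.
by apply: eq_bigr => a _; rewrite reflect_vecE (negPf (sink_i a)).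
Qed.

Lemma reflect_vecK : involutive (reflect_vec Q i).
Proof.
move=> x; apply/ffunP => v; rewrite reflect_vecE incoming_reflect !reflect_vecE.
by rewrite eqxx; case: eqP => // ->; rewrite subKr.
Qed.

(** Reflections are isometries between the two orientations; here the reflection
    is moved to the second argument. *)
Lemma euler_reverse_at x y :
  euler (reverse_at Q i) (reflect_vec Q i x) y = euler Q x (reflect_vec Q i y).
Proof.
rewrite /euler (bigD1 i) //= [X in _ = X - _](bigD1 i) //= !reflect_vecE eqxx.
rewrite (bigID (fun a => tgt Q a == i)) /=.
rewrite [X in _ = _ - X](bigID (fun a => tgt Q a == i)) /=.
have -> : \sum_(a | tgt Q a == i) reflect_vec Q i x (src (reverse_at Q i) a) *
            y (tgt (reverse_at Q i) a) = (incoming x - x i) * incoming y.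
  rewrite /incoming mulr_sumr; apply: eq_bigr => a tgt_a.
  rewrite [src _ a]ffunE [tgt (reverse_at _ _) a]ffunE tgt_a.
  by rewrite reflect_vecE eqxx.
have -> : \sum_(a | tgt Q a == i) x (src Q a) * reflect_vec Q i y (tgt Q a) =
    incoming x * (incoming y - y i).
  rewrite /incoming mulr_suml; apply: eq_bigr => a tgt_a.
  by rewrite reflect_vecE tgt_a.
have -> : \sum_(a | tgt Q a != i) reflect_vec Q i x (src (reverse_at Q i) a) *
            y (tgt (reverse_at Q i) a) =
          \sum_(a | tgt Q a != i) x (src Q a) * reflect_vec Q i y (tgt Q a).
  apply: eq_bigr => a /negPf tgt_a.
  rewrite [src _ a]ffunE [tgt (reverse_at _ _) a]ffunE tgt_a !reflect_vecE.
  by rewrite tgt_a (negPf (sink_i a)).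
have -> : \sum_(v | v != i) reflect_vec Q i x v * y v =
          \sum_(v | v != i) x v * reflect_vec Q i y v.
  by apply: eq_bigr => v /negPf v_i; rewrite !reflect_vecE v_i.
ring.
Qed.

(** The reflected functional is Theta composed with the reflection, whatever
    [alpha] represents it, so being canonical is preserved. *)
Lemma theta_can_reflect d d' alpha :
  qdim d' = reflect_vec Q i (qdim d) -> theta_can Q d = euler_left Q alpha ->
  euler_left (reverse_at Q i) (reflect_vec Q i alpha) =
  theta_can (reverse_at Q i) d'.
Proof.
move=> d'E can_alpha; apply/ffunP => v; rewrite !ffunE d'E !euler_reverse_at.
rewrite -stab_eval_left -can_alpha stab_eval_can; congr (_ - _).
by rewrite -{2}[basis_vec v]reflect_vecK euler_reverse_at reflect_vecK.
Qed.

End SinkReflection.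

Lemma euler_opposite (V A : finType) (Q : quiver V A) x y :
  euler (opposite Q) x y = euler Q y x.
Proof.
rewrite /euler; congr (_ - _); apply: eq_bigr => ? _; exact: mulrC.
Qed.

Lemma theta_can_opposite (V A : finType) (Q : quiver V A) d :
  theta_can (opposite Q) d = - theta_can Q d.
Proof.
apply/ffunP => v; rewrite !ffunE !euler_opposite; exact: esym (opprB _ _).
Qed.

Lemma duality_obtained (V A : finType) (Q : quiver V A) d :
  obtained_from (Q, d, theta_can Q d) (opposite Q, d, theta_can (opposite Q) d).
Proof. by rewrite theta_can_opposite; apply/rt_step/duality. Qed.

Lemma oppositeK (V A : finType) : involutive (@opposite V A).
Proof. by case. Qed.

Section StarOrientations.
Variable m : nat.
Implicit Types (Q : quiver (option 'I_m) 'I_m) (d : {ffun option 'I_m -> nat}).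

Definition star_oriented Q : Prop := forall l,
  (src Q l = Some l /\ tgt Q l = None) \/ (src Q l = None /\ tgt Q l = Some l).

Lemma star_oriented_same Q :
  same_underlying_graph (subspace_quiver m) Q -> star_oriented Q.
Proof. by move=> same l; have := same l; rewrite !ffunE. Qed.

Lemma star_oriented_subspace : star_oriented (subspace_quiver m).
Proof. by move=> l; left; rewrite !ffunE. Qed.

Lemma star_oriented_opposite Q : star_oriented Q -> star_oriented (opposite Q).
Proof. by move=> star l; case: (star l) => -[sl tl]; [right | left]. Qed.

Lemma star_oriented_reverse_at Q i :
  star_oriented Q -> star_oriented (reverse_at Q i).
Proof.
move=> star l; rewrite !ffunE.
by case: (star l) => -[-> ->]; case: eqP => [<-|_]; [right|left|left|right].
Qed.

Lemma star_tgt Q l v : star_oriented Q -> (tgt Q l == Some v) = (tgt Q l != None) && (l == v).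
Proof. by move=> /(_ l)[] [_ ->]. Qed.

Lemma star_src Q l : star_oriented Q -> tgt Q l != None -> src Q l = None.
Proof. by move=> /(_ l)[] [-> ->]. Qed.

(** The dimension vector in the subspace orientation obtained by reflecting at
    every arm that points away from the hub. *)
Definition normal_vec Q d : vec m :=
  [ffun v => if v is Some l then
               if tgt Q l == None then (d v)%:Z else (d None)%:Z - (d v)%:Z
             else (d v)%:Z].

Lemma normal_vec_subspace d : normal_vec (subspace_quiver m) d = zdim d.
Proof. by apply/ffunP => -[l|]; rewrite !ffunE. Qed.

Lemma normal_vec_opposite Q d : star_oriented Q ->
  normal_vec (opposite Q) d = flip_arms (normal_vec Q d).
Proof.
move=> star; apply/ffunP => -[l|]; rewrite !ffunE //=.
by case: (star l) => -[-> ->] /=; rewrite ?subKr.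
Qed.

Lemma incoming_arm Q l x : star_oriented Q -> tgt Q l != None ->
  incoming Q (Some l) x = x None.
Proof.
move=> star out; rewrite /incoming (big_pred1 l).
  by rewrite star_src.
by move=> a; rewrite star_tgt //=; have [->|] := eqVneq a l; rewrite ?out ?andbF.
Qed.

Lemma sink_hub Q l : star_oriented Q -> is_sink Q None -> tgt Q l = None.
Proof. by move=> star sink; case: (star l) => -[sl //]; have := sink l; rewrite sl eqxx. Qed.

Lemma sink_arm Q l : star_oriented Q -> is_sink Q (Some l) -> tgt Q l = Some l.
Proof. by move=> star sink; case: (star l) => -[sl //]; have := sink l; rewrite sl eqxx. Qed.

(** Duality gives C.  At a sink hub all arms point inwards, and after the
    reflection they all point outwards, hence C S.  At a sink arm the reflection
    is undone by the normal form. *)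
Lemma admissible_step_orbit D D' : admissible_step D D' ->
  star_oriented D.1.1 -> D.2 = theta_can D.1.1 D.1.2 ->
  [/\ star_oriented D'.1.1, D'.2 = theta_can D'.1.1 D'.1.2
    & dihedral_orbit (normal_vec D.1.1 D.1.2) (normal_vec D'.1.1 D'.1.2)].
Proof.
case=> [Q d Theta i d' alpha sink_i _ _ d'E ThetaE|Q d Theta] /= star canE; last first.
  split; first exact: star_oriented_opposite.
    by rewrite theta_can_opposite canE.
  by rewrite normal_vec_opposite //; apply/orbit_flip_arms/orbit_refl.
split; first exact: star_oriented_reverse_at.
  by apply: (theta_can_reflect sink_i d'E); rewrite -canE.
have d'v v : (d' v)%:R = reflect_vec Q i (qdim d) v :> rat.
  by rewrite -d'E ffunE.
case: i sink_i d'v {d'E ThetaE} => [l|] sink_i d'v.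
  have tl := sink_arm star sink_i.
  suff -> : normal_vec (reverse_at Q (Some l)) d' = normal_vec Q d by apply: orbit_refl.
  have d'N : d' None = d None.
    have := d'v None; rewrite reflect_vecE //= ffunE => /eqP.
    by rewrite eqr_nat => /eqP.
  apply/ffunP => -[k|]; rewrite !ffunE ?d'N //.
  have := d'v (Some k); rewrite reflect_vecE // (inj_eq Some_inj).
  have [->|neq_kl] := eqVneq k l.
    rewrite tl eqxx star_src ?tl //= incoming_arm ?tl // !ffunE => /eqP.
    by rewrite eq_sym subr_eq -natrD eqr_nat => /eqP ->; rewrite PoszD addrK.
  rewrite ffunE => /eqP; rewrite eqr_nat => /eqP ->.
  by rewrite star_tgt // (negPf neq_kl) andbF.
have tN l := sink_hub l star sink_i.
suff -> : normal_vec (reverse_at Q None) d' = flip_arms (flip_hub (normal_vec Q d)).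
  exact/orbit_flip_arms/orbit_flip_hub/orbit_refl.
have d'S l : d' (Some l) = d (Some l).
  have := d'v (Some l); rewrite reflect_vecE //= ffunE => /eqP.
  by rewrite eqr_nat => /eqP.
have d'N : (d' None)%:Z = arms (normal_vec Q d) - (d None)%:Z.
  have -> : arms (normal_vec Q d) = (\sum_l d (Some l))%N%:Z.
    by apply: arms_nat => l; rewrite ffunE tN.
  have := d'v None; rewrite reflect_vecE // eqxx [qdim d None]ffunE => /eqP.
  have -> : incoming Q None (qdim d) = (\sum_l d (Some l))%N%:R.
    rewrite /incoming natr_sum; apply: eq_big => [l|l _]; first by rewrite tN.
    by rewrite ffunE; case: (star l) => -[-> //]; rewrite tN.
  by rewrite eq_sym subr_eq -natrD eqr_nat => /eqP ->; rewrite PoszD addrK.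
apply/ffunP => -[l|]; rewrite !ffunE ?d'N //=.
by rewrite !tN /=; case: (star l) => -[->]; rewrite ?tN //= ?d'S.
Qed.

Lemma obtained_from_orbit Q d Q' d' : star_oriented Q ->
  obtained_from (Q, d, theta_can Q d) (Q', d', theta_can Q' d') ->
  dihedral_orbit (normal_vec Q d) (normal_vec Q' d').
Proof.
move=> star obt.
suff : forall D D', obtained_from D D' -> star_oriented D.1.1 ->
    D.2 = theta_can D.1.1 D.1.2 ->
    [/\ star_oriented D'.1.1, D'.2 = theta_can D'.1.1 D'.1.2
      & dihedral_orbit (normal_vec D.1.1 D.1.2) (normal_vec D'.1.1 D'.1.2)].
  by move=> /(_ _ _ obt star erefl)[].
move=> D D'; elim=> {D D'} [D D'|D|D D1 D' _ IH1 _ IH2] //.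
- exact: admissible_step_orbit.
- by split=> //; apply: orbit_refl.
by move=> star_D can_D; have [star1 can1 orb1] := IH1 star_D can_D;
   have [? ? orb2] := IH2 star1 can1; split=> //; apply: orbit_trans orb2.
Qed.

Lemma related_orbit d Q' d' : star_oriented Q' ->
  related (subspace_quiver m) d Q' d' ->
  dihedral_orbit (normal_vec Q' d') (zdim d).
Proof.
move=> star [] /obtained_from_orbit; rewrite normal_vec_subspace.
  by move=> /(_ star_oriented_subspace)/orbit_sym.
exact.
Qed.

(** A reflection step requires Theta = <alpha, _>.  As the star has no oriented
    cycle, [alpha] is found by solving along the arrows: inward arms, then the
    hub, then outward arms. *)
Lemma euler_left_onto Q Theta : star_oriented Q ->
  exists alpha, Theta = euler_left Q alpha.
Proof.
move=> star.
pose hub := Theta None + \sum_(l | tgt Q l == None) Theta (Some l).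
pose alpha : {ffun option 'I_m -> rat} := [ffun v =>
  if v is Some l then if tgt Q l == None then Theta v else Theta v + hub else hub].
exists alpha; apply/ffunP => v; rewrite ffunE euler_basis_right.
case: v => [l|].
  rewrite [alpha _]ffunE; have [tl|tl] := eqVneq (tgt Q l) None.
    rewrite big1 ?subr0 // => a _; rewrite star_tgt //.
    by have [->|] := eqVneq a l; rewrite ?tl ?andbF ?mulr0.
  rewrite (bigD1 l) //= star_tgt // tl eqxx mulr1 star_src // [alpha None]ffunE.
  rewrite big1 ?addr0 ?addrK // => a neq_a.
  by rewrite star_tgt // (negPf neq_a) andbF mulr0.
rewrite [alpha None]ffunE /hub big_mkcond /= -addrA -sumrB big1 ?addr0 // => l _.
case: eqP => [tl|]; last by rewrite mulr0 subr0.
case: (star l) => -[->]; last by rewrite tl.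
by rewrite ffunE tl eqxx mulr1 subrr.
Qed.

Definition flip_arm d (l : 'I_m) : {ffun option 'I_m -> nat} :=
  [ffun v => if v == Some l then (d None - d v)%N else d v].

Lemma flip_arm_step Q d l : star_oriented Q -> tgt Q l != None ->
  (d (Some l) <= d None)%N -> (0 < d None)%N ->
  admissible_step (Q, d, theta_can Q d)
    (reverse_at Q (Some l), flip_arm d l,
     theta_can (reverse_at Q (Some l)) (flip_arm d l)).
Proof.
move=> star out le_d d_gt0.
have sink : is_sink Q (Some l).
  move=> a; apply/eqP => sa; case: (star a) => -[]; rewrite sa // => -[al] ta.
  by rewrite -al in ta; rewrite ta in out.
have [alpha alphaE] := euler_left_onto (theta_can Q d) star.
have flipE : qdim (flip_arm d l) = reflect_vec Q (Some l) (qdim d).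
  apply/ffunP => v; rewrite reflect_vecE // incoming_arm // !ffunE.
  by case: eqP => [->|] //; rewrite natrB.
rewrite -(theta_can_reflect sink flipE alphaE).
apply: sink_reflection => //.
  by rewrite euler_sink incoming_arm // !ffunE subr_le0 ler_nat.
rewrite !ffunE euler_sink euler_from_sink // incoming_arm // !ffunE.
by rewrite addrAC subrr sub0r oppr_lt0 ltr0n.
Qed.

(** The reversed arm is a source; dualise, reflect at the resulting sink, and
    dualise again. *)
Lemma flip_arm_step_back Q d l : star_oriented Q -> tgt Q l != None ->
  (d (Some l) <= d None)%N -> (0 < d None)%N ->
  obtained_from (reverse_at Q (Some l), flip_arm d l,
                 theta_can (reverse_at Q (Some l)) (flip_arm d l))
    (Q, d, theta_can Q d).
Proof.
move=> star out le_d d_gt0; set Q1 := reverse_at Q (Some l).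
have star1 : star_oriented Q1 by apply: star_oriented_reverse_at.
have out1 : tgt (opposite Q1) l != None.
  by rewrite /= ffunE star_tgt // out eqxx.
have Q2E : reverse_at (opposite Q1) (Some l) = opposite Q.
  have E a : (if src Q1 a == Some l then Some l else tgt Q1 a) = tgt Q a /\
             (if src Q1 a == Some l then tgt Q1 a else src Q1 a) = src Q a.
    rewrite !ffunE !star_tgt // [a == l]eq_sym; have [<-|neq] := eqVneq l a.
      by rewrite out star_src // eqxx; case: (star l) out => -[_ ->].
    rewrite andbF; case: (star a) => -[-> ->] //=.
    by rewrite (inj_eq Some_inj) eq_sym (negPf neq).
  by rewrite /reverse_at /opposite; congr Quiver; apply/ffunP => a;
     rewrite ffunE /=; case: (E a).
have d2E : flip_arm (flip_arm d l) l = d.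
  by apply/ffunP => v; rewrite !ffunE; case: eqP => [->|//]; rewrite /= subKn.
apply: rt_trans (duality_obtained _ _) _.
have := flip_arm_step (star_oriented_opposite star1) out1 (d := flip_arm d l).
rewrite Q2E d2E !ffunE eqxx leq_subr => /(_ isT d_gt0) step.
apply: rt_trans (rt_step _ _ _ _ step) _.
by have := duality_obtained (opposite Q) d; rewrite oppositeK.
Qed.

Lemma flip_to_subspace Q d : star_oriented Q ->
  (forall l, (d (Some l) <= d None)%N) -> (0 < d None)%N ->
  exists x, [/\ zdim x = normal_vec Q d,
    obtained_from (Q, d, theta_can Q d)
      (subspace_quiver m, x, theta_can (subspace_quiver m) x)
  & obtained_from (subspace_quiver m, x, theta_can (subspace_quiver m) x)
      (Q, d, theta_can Q d)].
Proof.
have [s] := ubnP #|[set l | tgt Q l != None]|; elim: s Q d => // s IHs Q d.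
rewrite ltnS => le_s star le_d d_gt0.
have [inw|/existsNP[l /eqP out]] := pselect (forall l, tgt Q l = None).
  have -> : Q = subspace_quiver m.
    case: Q star inw {le_s} => sQ tQ star inw.
    congr Quiver; apply/ffunP => l; rewrite ffunE; last exact: inw.
    by case: (star l) => -[//]; rewrite inw.
  by exists d; split; [rewrite normal_vec_subspace | apply: rt_refl | apply: rt_refl].
pose Q1 := reverse_at Q (Some l); pose d1 := flip_arm d l.
have tQ1 a : (tgt Q1 a != None) = (tgt Q a != None) && (a != l).
  rewrite ffunE star_tgt //; have [->|neq] := eqVneq a l.
    by rewrite out star_src ?andbF.
  by rewrite andbF andbT.
have [||||x [xE to_x from_x]] := IHs Q1 d1.
- apply: leq_trans le_s; apply: proper_card; apply/properP; split.
    by apply/fintype.subsetP => a; rewrite !inE tQ1 => /andP[].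
  by exists l; rewrite !inE ?tQ1 ?out // eqxx.
- exact: star_oriented_reverse_at.
- by move=> a; rewrite !ffunE /=; case: eqP => _; rewrite ?leq_subr.
- by rewrite ffunE.
exists x; split.
- rewrite xE; apply/ffunP => -[a|]; rewrite [LHS]ffunE [RHS]ffunE; last by rewrite ffunE.
  have := tQ1 a; rewrite [d1 None]ffunE [d1 _]ffunE (inj_eq Some_inj) /=.
  have [->|neq] := eqVneq a l.
    by rewrite out /= => /negPn ->; rewrite (negPf out) subzn.
  by rewrite andbT => /negb_inj ->.
- by apply: rt_trans to_x; apply/rt_step/flip_arm_step.
by apply: rt_trans from_x _; apply: flip_arm_step_back.
Qed.

(** The second vector comes from the dual orientation. *)
Lemma related_subspace Q d Q' d' : star_oriented Q' ->
  (forall l, (d' (Some l) <= d' None)%N) -> (0 < d' None)%N ->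
  related Q d Q' d' ->
  exists x x', [/\ zdim x = normal_vec Q' d', zdim x' = flip_arms (normal_vec Q' d'),
    related Q d (subspace_quiver m) x & related Q d (subspace_quiver m) x'].
Proof.
move=> star le_d' d'_gt0 rel.
have [x [xE to_x from_x]] := flip_to_subspace star le_d' d'_gt0.
have [x' [x'E to_x' from_x']] :=
  flip_to_subspace (star_oriented_opposite star) le_d' d'_gt0.
rewrite normal_vec_opposite // in x'E.
have dual := duality_obtained Q' d'.
have dual_back := duality_obtained (opposite Q') d'; rewrite oppositeK in dual_back.
exists x, x'; split=> //; case: rel => rel; [left|right|left|right].
- exact: rt_trans to_x.
- exact: rt_trans rel.
- by apply: rt_trans rel _; apply: rt_trans dual _.
by apply: rt_trans rel; apply: rt_trans dual_back.
Qed.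

End StarOrientations.

(** * Classification *)

Section Classification.
Variable m : nat.
Implicit Types (f : 'I_m -> nat) (d : {ffun option 'I_m -> nat}).

Definition multiplicity f v : nat := #|[set l | f l == v]|.

Lemma sum_by_value f (g : nat -> nat) N : (forall l, f l < N)%N ->
  (\sum_l g (f l) = \sum_(v < N) multiplicity f v * g v)%N.
Proof.
move=> lt_f; under [RHS]eq_bigr do rewrite -sum_indicator.
rewrite exchange_big; apply: eq_bigr => l _ /=.
rewrite (bigD1 (Ordinal (lt_f l))) //= inE eqxx mul1n big1 ?addn0 // => v.
by rewrite inE -(inj_eq val_inj) eq_sym /= => /negPf ->.
Qed.

Lemma fundamental_inequalities d :
  in_fundamental_domain (subspace_quiver m) d ->
  [/\ (0 < d None)%N, forall l, (2 * d (Some l) <= d None)%N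
    & (2 * d None <= \sum_l d (Some l))%N].
Proof.
move=> [d_neq0 _ fund].
have armle l : (2 * d (Some l) <= d None)%N.
  have := fund (Some l); rewrite /sym_euler euler_basis_left euler_basis_right.
  rewrite [X in _ - X + _]big1 => [|a _]; last by rewrite [tgt _ a]ffunE mulr0.
  rewrite (bigD1 l) //= big1 => [|a neq_a].
    by rewrite !ffunE eqxx mul1r addr0 subr0 addrA -natrD subr_le0 ler_nat addnn -mul2n.
  by rewrite !ffunE (inj_eq Some_inj) (negPf neq_a) mul0r.
split=> //.
  rewrite lt0n; apply: contra_neq d_neq0 => d0; apply/ffunP => -[l|]; rewrite ffunE //.
  by have := armle l; rewrite d0 leqn0 muln_eq0 => /eqP.
have := fund None; rewrite /sym_euler euler_basis_left euler_basis_right.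
rewrite [X in _ + (_ - X)]big1 => [|a _]; last by rewrite !ffunE mul0r.
have -> : \sum_a qdim d (src (subspace_quiver m) a) *
            (tgt (subspace_quiver m) a == None)%:R = (\sum_l d (Some l))%N%:R.
  by rewrite natr_sum; apply: eq_bigr => l _; rewrite !ffunE eqxx mulr1.
by rewrite subr0 addrAC ffunE -natrD subr_le0 ler_nat addnn -mul2n.
Qed.

(** Writing -2 <d, d> = 6 as sum f (n - 2 f) + n (sum f - 2 n), both terms are
    non-negative.  An arm with 2 f < n contributes at least (n - 1) / 2, and if
    there is none then n divides 6; so n <= 13, and the multiplicities of the
    values 1, ..., 6 solve a small linear problem for each n. *)
Lemma fundamental_minus3 f n :
  (forall l, (0 < f l)%N) -> (forall l, (2 * f l <= n)%N) ->
  (2 * n <= \sum_l f l)%N -> (\sum_l f l * (n - f l) = n ^ 2 + 3)%N ->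
  [\/ n = 2%N /\ m = 7%N, n = 3%N /\ m = 6%N
    | [/\ n = 4%N, m = 5%N, multiplicity f 1 = 1%N & multiplicity f 2 = 4%N]].
Proof.
move=> f_gt0 le_f le_sum form.
have defect : (n * \sum_l f l + \sum_l f l * (n - 2 * f l) = 2 * n ^ 2 + 6)%N.
  have -> : (2 * n ^ 2 + 6 = 2 * \sum_l f l * (n - f l))%N by rewrite form; lia.
  rewrite !big_distrr -big_split /=; apply: eq_bigr => l _.
  by have := le_f l; nia.
have n_le13 : (n <= 13)%N.
  have [[l lt_l]|all_half] := pselect (exists l, (2 * f l < n)%N).
    have : (f l * (n - 2 * f l) <= \sum_l f l * (n - 2 * f l))%N.
      by rewrite (bigD1 l) //= leq_addr.
    by have := f_gt0 l; nia.
  rewrite [X in (_ + X)%N = _]big1 in defect.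
    move: le_sum defect; move: (\sum_l f l)%N => S; rewrite -mulnn addn0.
    by rewrite leq_eqVlt => /orP[/eqP <-|lt_sum]; nia.
  move=> l _; apply/eqP; rewrite muln_eq0 subn_eq0 leqNgt orbC.
  by case: ltnP => // lt_l; case: all_half; exists l.
have lt_f l : (f l < 7)%N by have := le_f l; lia.
have cnt0 v : (n < 2 * v)%N -> multiplicity f v = 0%N.
  move=> lt_v; apply/eqP; rewrite cards_eq0; apply/eqP/setP => l.
  by rewrite !inE; apply/eqP => fl; have := le_f l; lia.
have cnt00 : multiplicity f 0 = 0%N.
  apply/eqP; rewrite cards_eq0; apply/eqP/setP => l.
  by rewrite !inE eqn0Ngt f_gt0.
have mE : (m = \sum_(v < 7) multiplicity f v * 1)%N.
  by rewrite -(sum_by_value (fun=> 1%N) lt_f) sum_nat_const card_ord muln1.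
have sumE := sum_by_value id lt_f.
have formE := sum_by_value (fun v => v * (n - v))%N lt_f.
rewrite sumE in le_sum; rewrite formE in form.
suff : ((n = 2 /\ m = 7) \/ (n = 3 /\ m = 6) \/
       (n = 4 /\ m = 5 /\ multiplicity f 1 = 1 /\ multiplicity f 2 = 4))%N.
  by case=> [[? ?]|[[? ?]|[? [? [? ?]]]]]; [constructor 1|constructor 2|constructor 3].
move: le_sum form mE (cnt0 1%N) (cnt0 2%N) (cnt0 3%N) (cnt0 4%N) (cnt0 5%N) (cnt0 6%N).
rewrite !big_ord_recl !big_ord0 /= /bump /= cnt00.
move: (multiplicity f 1) (multiplicity f 2) (multiplicity f 3) (multiplicity f 4)
  (multiplicity f 5) (multiplicity f 6) => c1 c2 c3 c4 c5 c6.
clear -n_le13.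
do 14 (case: n n_le13 => [|n] n_le13; first by lia).
by [].
Qed.

Lemma perm_two_values (s : seq nat) u v : u != v ->
  all (fun z => (z == u) || (z == v)) s ->
  perm_eq s (nseq (count_mem u s) u ++ nseq (count_mem v s) v).
Proof.
move=> neq_uv /allP uv; apply/allP => z _ /=; apply/eqP.
rewrite count_cat !count_nseq /=.
have [<-|neq_uz] := eqVneq u z.
  by rewrite eq_sym (negPf neq_uv) mul1n mul0n addn0.
have [<-|neq_vz] := eqVneq v z; first by rewrite mul1n.
apply/count_memPn; apply/negP => /uv.
by rewrite ![z == _]eq_sym (negPf neq_uz) (negPf neq_vz).
Qed.

End Classification.

Section Conclusion.
Variables (F : closedFieldType) (m : nat).
Implicit Types (d : {ffun option 'I_m -> nat}).
Notation Q := (subspace_quiver m).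

(** After a duality if necessary, the normal form [x] has arm [k] equal to the
    hub.  Both ends of the list in [orbit_outward] are then extremal, and [d],
    whose arms lie strictly between zero and the hub, is outward of one of
    them. *)
Lemma zero_arm_not_ample Q' d d' k : star_oriented Q' ->
  in_fundamental_domain Q d' -> d' (Some k) = 0%N ->
  dihedral_orbit (normal_vec Q' d') (zdim d) ->
  (forall l, (0 < d (Some l))%N) -> (forall l, (d (Some l) < d None)%N) ->
  ~ amply_stable F Q d (theta_can Q d) /\
  ~ strongly_amply_stable Q d (theta_can Q d).
Proof.
move=> star /fundamental_inequalities[d'_gt0 le_d' le_sum] d'k orb d_gt0 d_lt.
(* Choose the orientation in which arm [k] points away from the hub, so that its
   normal entry is n - 0 = n. *)
pose Q1 := if tgt Q' k == None then opposite Q' else Q'.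
have star1 : star_oriented Q1.
  by rewrite /Q1; case: ifP => // _; apply: star_oriented_opposite.
have out1 : tgt Q1 k != None.
  rewrite /Q1; case: ifP => [/eqP tk|/negbT //].
  by case: (star k) => -[/= ->] //; rewrite tk.
have orb1 : dihedral_orbit (normal_vec Q1 d') (zdim d).
  rewrite /Q1; case: ifP => // _; rewrite normal_vec_opposite //.
  apply: orbit_trans orb; apply: orbit_sym; exact/orbit_flip_arms/orbit_refl.
set x := normal_vec Q1 d' in orb1.
have xN : x None = (d' None)%:Z by rewrite ffunE.
have xk : x (Some k) = x None by rewrite !ffunE (negPf out1) d'k subr0.
have x_lo l : (d' (Some l))%:Z <= x (Some l).
  by rewrite ffunE; case: ifP => // _; have := le_d' l; lia.
have x_hi l : x (Some l) <= (d' None)%:Z - (d' (Some l))%:Z.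
  by rewrite ffunE; case: ifP => // _; have := le_d' l; lia.
have sum_d' : (\sum_l (d' (Some l))%:Z) = (\sum_l d' (Some l))%N%:Z.
  by rewrite -arms_zdim; apply: eq_bigr => l _; rewrite ffunE.
have arms_lo : (\sum_l d' (Some l))%N%:Z + (d' None)%:Z <= arms x.
  rewrite -sum_d' (bigD1 k) //= d'k add0r addrC /arms [leRHS](bigD1 k) //= xk xN.
  by rewrite lerD2l ler_sum.
have arms_hi : arms x + (\sum_l d' (Some l))%N%:Z <= (d' None)%:Z *+ m.
  rewrite -sum_d' -big_split /= -[m in _ *+ m]card_ord -sumr_const ler_sum // => l _.
  by rewrite -lerBrDr.
have m_ge5 : (5 <= m)%N.
  have : (2 * \sum_l d' (Some l) <= m.-1 * d' None)%N.
    rewrite (bigD1 k) //= d'k add0n big_distrr /=.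
    apply: (@leq_trans (\sum_(l | l != k) d' None)); first exact: leq_sum.
    by rewrite sum_nat_const cardC1 card_ord.
  by have := ltn_ord k; nia.
have ext : extremal x k.
  split=> //.
  - move=> l; rewrite (le_trans _ (x_lo l)) //= (le_trans (x_hi l)) //.
    by rewrite xN gerBl.
  - by rewrite xN.
  - by rewrite xN; apply: le_trans arms_lo; lia.
have ext' : extremal (flip_arms (flip_hub (flip_arms x))) k.
  apply: extremal_opposite => //; rewrite xN.
  by apply: le_trans arms_hi; lia.
have m_ge4 := ltnW m_ge5.
have d_pos v : (0 < d v)%N.
  by case: v => [l|]; [exact: d_gt0 | exact: leq_ltn_trans (leq0n _) (d_lt k)].
have [d_in|[o [b out]]] := orbit_outward k orb1; last first.
  by case: out => out; split;
     solve [apply: outward_not_ample out => // | apply: outward_not_strongly_ample out => //].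
have dk : zdim d (Some k) != 0 /\ zdim d (Some k) != zdim d None.
  by rewrite !ffunE; have := d_gt0 k; have := d_lt k; lia.
clearbody x; case: dk => dk0 dkN; move: d_in; rewrite !inE.
case/or4P => /eqP dE; move: dk0 dkN; rewrite dE ?ffunE ?xk ?arms_flip_arms ?subrr ?eqxx //=.
by rewrite subr0 eqxx.
Qed.

End Conclusion.

Section Tuples.
Variable m : nat.
Implicit Types (d x y : {ffun option 'I_m -> nat}) (o : quiver (option 'I_m) 'I_m).
Notation Q := (subspace_quiver m).

Definition arm_tuple x : m.-tuple nat := [tuple x (Some l) | l < m].

Lemma subspace_dim_arm_tuple x : subspace_dim (arm_tuple x) (x None) = x.
Proof. by apply/ffunP => -[l|]; rewrite ffunE ?tnth_mktuple. Qed.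

Lemma count_arm_tuple x c :
  count_mem c (arm_tuple x) = multiplicity (fun l => x (Some l)) c.
Proof.
rewrite /multiplicity cardsE cardE size_filter /= count_map -enumT.
by apply: eq_count.
Qed.

Lemma multiplicity2 (f : 'I_m -> nat) u v : u != v ->
  (forall l, f l = u \/ f l = v) ->
  (multiplicity f u + multiplicity f v = m)%N.
Proof.
move=> neq_uv uv; rewrite /multiplicity.
have -> : [set l | f l == v] = ~: [set l | f l == u].
  apply/setP => l; rewrite !inE; case: (uv l) => ->; rewrite eqxx.
    by rewrite (negPf neq_uv).
  by rewrite eq_sym neq_uv.
by rewrite cardsC card_ord.
Qed.

Lemma perm_arm_tuple x u v : u != v ->
  (forall l, x (Some l) = u \/ x (Some l) = v) ->
  perm_eq (arm_tuple x) (nseq (multiplicity (fun l => x (Some l)) u) u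
                         ++ nseq (multiplicity (fun l => x (Some l)) v) v).
Proof.
move=> neq_uv uv; rewrite -!count_arm_tuple; apply: perm_two_values => //.
by apply/allP => z /mapP[l _ ->] /=; case: (uv l) => ->; rewrite eqxx ?orbT.
Qed.

Lemma normal_vec_arm o d x l :
  zdim x = normal_vec o d -> (d (Some l) <= d None)%N ->
  x (Some l) = d (Some l) \/ x (Some l) = (d None - d (Some l))%N.
Proof.
move=> /ffunP/(_ (Some l)); rewrite !ffunE; case: ifP => _ xl le_d; [left|right].
  by case: xl.
by apply/eqP; rewrite -eqz_nat xl subzn.
Qed.

Lemma normal_vec_form o d : (forall l : 'I_m, d (Some l) <= d None)%N ->
  star_form (normal_vec o d) (normal_vec o d) =
  (d None ^ 2)%N%:Z - (\sum_l d (Some l) * (d None - d (Some l)))%N%:Z.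
Proof.
move=> le_d.
have -> : (\sum_l d (Some l) * (d None - d (Some l)))%N%:Z =
    \sum_l (d (Some l) * (d None - d (Some l)))%N%:Z.
  by rewrite -natz natr_sum; apply: eq_bigr => l _; rewrite natz.
rewrite /star_form /arms [normal_vec o d None]ffunE mulr_suml -mulnn PoszM.
rewrite addrAC -sumrB addrC -sumrN; congr (_ + _); apply: eq_bigr => l _.
by rewrite PoszM -subzn // ffunE; case: ifP => _; ring.
Qed.

Lemma flip_arms_nat x x' : zdim x' = flip_arms (zdim x) ->
  (forall l, x (Some l) <= x None)%N ->
  x' None = x None /\ forall l, x' (Some l) = (x None - x (Some l))%N.
Proof.
move=> /ffunP x'E le_x; split=> [|l].
  by have := x'E None; rewrite !ffunE => -[].
by apply/eqP; rewrite -eqz_nat -subzn //; have := x'E (Some l); rewrite !ffunE => ->.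
Qed.

End Tuples.

Lemma wall_three_dims (F : fieldType) m (d x : {ffun option 'I_m -> nat}) :
  dihedral_orbit (zdim x) (zdim d) -> star_form (zdim x) (zdim x) < 0 ->
  x None = 3%N -> (forall l, x (Some l) = 1%N \/ x (Some l) = 2%N) ->
  (3 %| \sum_l x (Some l))%N -> (0 < m)%N ->
  in_proper_wall F (subspace_quiver m) d (theta_can (subspace_quiver m) d).
Proof.
move=> orb neg xN x12 /dvdnP[k sum_x] m_gt0; apply: in_proper_wall_of_on_wall.
apply: (on_wall_orbit orb neg).
apply: (@line_plane_wall F m (zdim x) (fun l => x (Some l)) k) => //.
- by rewrite ffunE xN.
- by move=> l; rewrite ffunE.
- by rewrite sum_x mulnC.
rewrite lt0n; apply/eqP => k0; move: sum_x; rewrite k0 mul0n => /eqP.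
rewrite sum_nat_eq0 => /forallP/(_ (Ordinal m_gt0)) /=.
by case: (x12 (Ordinal m_gt0)) => ->.
Qed.

Theorem theorem16 (R : realType) (m : nat) (e : m.-tuple nat) (n : nat)
    (m_ge1 : (1 <= m)%N)
    (e_gt0 : forall k : 'I_m, (0 < tnth e k)%N)
    (e_sorted : sorted leq e)
    (e_ltn : forall k : 'I_m, (tnth e k < n)%N)
    (d_fund : exists (Q' : quiver (option 'I_m) 'I_m)
                     (d' : {ffun option 'I_m -> nat}),
       [/\ same_underlying_graph (subspace_quiver m) Q',
           in_fundamental_domain (subspace_quiver m) d'
         & related (subspace_quiver m) (subspace_dim e n) Q' d'])
    (d_euler : euler (subspace_quiver m) (qdim (subspace_dim e n))
                 (qdim (subspace_dim e n)) = - 3%:R)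
    (d_wall : ~ in_proper_wall R[i] (subspace_quiver m) (subspace_dim e n)
                  (theta_can (subspace_quiver m) (subspace_dim e n)))
    (d_ample :
       amply_stable R[i] (subspace_quiver m) (subspace_dim e n)
         (theta_can (subspace_quiver m) (subspace_dim e n))
       \/ strongly_amply_stable (subspace_quiver m) (subspace_dim e n)
            (theta_can (subspace_quiver m) (subspace_dim e n))) :
  exists (e' : m.-tuple nat) (n' : nat),
    related (subspace_quiver m) (subspace_dim e n)
            (subspace_quiver m) (subspace_dim e' n')
    /\ [\/ [/\ m = 5%N, perm_eq e' [:: 1; 2; 2; 2; 2]%N & n' = 4%N],
           [/\ m = 6%N, perm_eq e' [:: 1; 1; 1; 1; 1; 2]%N & n' = 3%N],
           [/\ m = 6%N, perm_eq e' [:: 1; 1; 1; 1; 2; 2]%N & n' = 3%N]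
         | [/\ m = 7%N, perm_eq e' [:: 1; 1; 1; 1; 1; 1; 1]%N & n' = 2%N]].
Proof.
set d := subspace_dim e n in d_fund d_euler d_wall d_ample *.
case: d_fund => Q' [d' [/star_oriented_same star fund rel]].
have orb := related_orbit star rel.
have [d'_gt0 le_d' sum_d'] := fundamental_inequalities fund.
have le_d'1 l : (d' (Some l) <= d' None)%N by have := le_d' l; lia.
have [[k /eqP d'k]|no_zero] := pselect (exists k, d' (Some k) == 0%N).
  have dS l : d (Some l) = tnth e l by rewrite ffunE.
  have dN : d None = n by rewrite ffunE.
  have [||not_ample not_strong] :=
    @zero_arm_not_ample R[i] m Q' d d' k star fund d'k orb.
  - by move=> l; rewrite dS.
  - by move=> l; rewrite dS dN.
  by case: d_ample.
have d'S_gt0 l : (0 < d' (Some l))%N.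
  by rewrite lt0n; apply/negP => d'l; apply: no_zero; exists l.
have [x [x' [xE x'E rel_x rel_x']]] := related_subspace star le_d'1 d'_gt0 rel.
have xN : x None = d' None by have /ffunP/(_ None) := xE; rewrite !ffunE => -[].
have xS l := normal_vec_arm xE (le_d'1 l).
have le_x l : (x (Some l) <= x None)%N.
  by rewrite xN; have := le_d'1 l; case: (xS l) => ->; rewrite ?leq_subr.
have [x'N x'S] : x' None = x None /\ forall l, x' (Some l) = (x None - x (Some l))%N.
  by apply: flip_arms_nat => //; rewrite xE.
have form_d : star_form (zdim d) (zdim d) = - 3%:Z.
  by apply: (@intr_inj rat); rewrite -euler_subspace -qdim_zdim d_euler.
have form_x : star_form (zdim x) (zdim x) = - 3%:Z.
  by rewrite xE -(orbit_form orb).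
have form_d' : (\sum_l d' (Some l) * (d' None - d' (Some l)) = d' None ^ 2 + 3)%N.
  by move: form_x; rewrite xE normal_vec_form //; lia.
pose outcome (y : {ffun option 'I_m -> nat}) :=
   [\/ [/\ m = 5%N, perm_eq (arm_tuple y) [:: 1; 2; 2; 2; 2]%N & y None = 4%N],
       [/\ m = 6%N, perm_eq (arm_tuple y) [:: 1; 1; 1; 1; 1; 2]%N & y None = 3%N],
       [/\ m = 6%N, perm_eq (arm_tuple y) [:: 1; 1; 1; 1; 2; 2]%N & y None = 3%N]
     | [/\ m = 7%N, perm_eq (arm_tuple y) [:: 1; 1; 1; 1; 1; 1; 1]%N & y None = 2%N]].
suff [out|out] : outcome x \/ outcome x'.
- by exists (arm_tuple x), (x None); rewrite subspace_dim_arm_tuple.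
- by exists (arm_tuple x'), (x' None); rewrite subspace_dim_arm_tuple.
have [[hub m7]|[hub m6]|[hub m5 mult1 mult2]] :=
  fundamental_minus3 d'S_gt0 le_d' sum_d' form_d'.
- left; constructor 4; split=> //; last by rewrite xN.
  have x1 l : x (Some l) = 1%N.
    by have := d'S_gt0 l; have := le_d' l; case: (xS l) => ->; lia.
  have x10 l : x (Some l) = 1%N \/ x (Some l) = 0%N by left.
  have := perm_arm_tuple (isT : 1%N != 0%N) x10.
  have := multiplicity2 (isT : 1%N != 0%N) x10.
  have -> : multiplicity (fun l => x (Some l)) 0 = 0%N.
    by apply/eqP; rewrite cards_eq0; apply/eqP/setP => l; rewrite !inE x1.
  by rewrite addn0 => mult1; rewrite (etrans mult1 m7).
- have x12 l : x (Some l) = 1%N \/ x (Some l) = 2%N.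
    by have := d'S_gt0 l; have := le_d' l; case: (xS l) => ->; lia.
  have x'12 l : x' (Some l) = 1%N \/ x' (Some l) = 2%N.
    by rewrite x'S xN hub; case: (x12 l) => ->; [right|left].
  (* The flip exchanges the values 1 and 2. *)
  have mult_x' u : (u <= 3)%N -> multiplicity (fun l => x' (Some l)) (3 - u)%N =
                   multiplicity (fun l => x (Some l)) u.
    move=> le_u; apply: eq_card => l; rewrite !inE x'S xN hub.
    by case: (x12 l) => ->; case: u le_u => [|[|[|[|]]]].
  have sum12 := etrans (multiplicity2 (isT : 1%N != 2%N) x12) m6.
  have perm := perm_arm_tuple (isT : 1%N != 2%N) x12.
  have perm' := perm_arm_tuple (isT : 1%N != 2%N) x'12.
  rewrite (mult_x' 2%N isT : multiplicity _ 1 = _) in perm'.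
  rewrite (mult_x' 1%N isT : multiplicity _ 2 = _) in perm'.
  (* With c2 twos the sum is 6 + c2, so the wall rules out c2 = 0, 3, 6. *)
  have no_wall : ~~ (3 %| \sum_l x (Some l))%N.
    apply/negP => div3; apply: d_wall; apply: (@wall_three_dims _ m d x) => //.
    + by rewrite xE.
    + by rewrite form_x.
    + by rewrite xN.
  have lt_x l : (x (Some l) < 3)%N by case: (x12 l) => ->.
  rewrite (sum_by_value id lt_x) !big_ord_recl big_ord0 /= muln0 add0n in no_wall.
  rewrite /bump /= in no_wall; rewrite /outcome x'N xN hub.
  move: no_wall perm perm' sum12.
  move: (multiplicity _ 1) (multiplicity _ 2) => c1 c2 no_wall + + sum12.
  have c1E : c1 = (6 - c2)%N by lia.
  have : (c2 <= 6)%N by lia.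
  move: no_wall; rewrite {}c1E {sum12}.
  by case: c2 => [|[|[|[|[|[|[|]]]]]]] // _ _ perm perm';
    [left; constructor 2 | left; constructor 3 | right; constructor 3 | right; constructor 2].
have [l0 mult1E] : exists l0, [set l | d' (Some l) == 1%N] = [set l0].
  by apply/cards1P/eqP.
have d'l0 : d' (Some l0) = 1%N.
  by apply/eqP; have := set11 l0; rewrite -mult1E inE.
have d'2 l : l != l0 -> d' (Some l) = 2%N.
  move=> neq_l; have : d' (Some l) != 1%N.
    apply: contra neq_l => d'l.
    have : l \in [set l | d' (Some l) == 1%N] by rewrite inE.
    by rewrite mult1E inE.
  have := le_d' l; have := d'S_gt0 l; rewrite hub.
  by case: (d' (Some l)) => [|[|[|k]]] //; lia.
(* The exceptional arm is 1 in [x] or, when reflected to 3, in [flip_arms x]. *)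
have good (y : {ffun option 'I_m -> nat}) : y None = 4%N -> y (Some l0) = 1%N ->
    (forall l, l != l0 -> y (Some l) = 2%N) -> outcome y.
  move=> yN y0 y2; constructor 1; split=> //.
  have y12 l : y (Some l) = 1%N \/ y (Some l) = 2%N.
    by have [->|/y2] := eqVneq l l0; [left | right].
  have y_mult1 : multiplicity (fun l => y (Some l)) 1 = 1%N.
    apply/eqP/cards1P; exists l0; apply/setP => l; rewrite !inE.
    by have [->|/y2 ->] := eqVneq l l0; rewrite ?y0.
  have := perm_arm_tuple (isT : 1%N != 2%N) y12.
  have := multiplicity2 (isT : 1%N != 2%N) y12.
  by rewrite y_mult1 add1n => y_sum; have [->] := etrans y_sum m5.
have x2 l : l != l0 -> x (Some l) = 2%N.
  by move=> /d'2 d'l; case: (xS l) => ->; rewrite d'l ?hub.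
have [x0|x0] := xS l0.
  by left; apply: good => //; rewrite ?xN // x0 d'l0.
right; apply: good; first by rewrite x'N xN.
  by rewrite x'S x0 xN hub d'l0.
by move=> l /x2 xl; rewrite x'S xl xN hub.
Qed.
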